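(* Let $n\ge 5$ and let $G=G_1\ast\dots\ast G_n$ be a free splitting of a group $G$ where each $G_i$ is non-trivial. Write $[n]=\{1,\dots,n\}$. For $i\in[n]$ and $j\in[n]-\{i\}$ let $f_{i_j}:G_i\to G_{i_j}$ be the group isomorphism onto the group $G_{i_j}\cong G_i$ described in the context, and for $g\in G_i$ let $\mathrm{Ad}_{G_i}(g)$ be the inner automorphism $x\mapsto g^{-1}xg$ of $G_i$. Then $\mathrm{Out}(G;G_1,\dots,G_n)$ is generated by the $n(n-1)$ groups $G_{i_j}$ and by $\Phi=\prod_{i=1}^n\mathrm{Aut}(G_i)$, subject to the relations: 1. $[f_{i_j}(g),f_{i_k}(h)]=1$ for all $g,h\in G_i$, for all $i\in[n]$ and all distinct $j,k\in[n]-\{i\}$; 2. $[f_{i_j}(g),f_{k_l}(h)]=1$ for all $g\in G_i$, $h\in G_k$, for all distinct $i,j,k,l\in[n]$; 3. $[f_{j_k}(g),f_{i_j}(h)f_{i_k}(h)]=1$ for all $g\in G_j$, $h\in G_i$, for all distinct $i,j,k\in[n]$; 4. $f_{i_{v_1}}(g)\cdots f_{i_{v_{n-1}}}(g)=\mathrm{Ad}_{G_i}(g)$ for all $g\in G_i$, for all $i\in[n]$, where $\{v_1,\dots,v_{n-1}\}=[n]-\{i\}$; 5. $\varphi^{-1}f_{i_j}(g)\varphi=f_{i_j}(\varphi(g))$ for all $g\in G_i$, for all distinct $i,j\in[n]$ and all $\varphi\in\Phi$; together with all relations in the groups $G_{i_j}$ and in $\Phi$.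
   Context: $\mathrm{Out}(G;G_1,\dots,G_n)$ is the group of pure symmetric outer automorphisms of the splitting: the subgroup of $\mathrm{Out}(G)=\mathrm{Aut}(G)/\mathrm{Inn}(G)$ of those classes having a representative $\psi\in\mathrm{Aut}(G)$ such that for each $i$ there is $g_i\in G$ with $\psi(G_i)=g_i^{-1}G_ig_i$. Automorphisms act on the right, so a product $\psi\chi$ means first $\psi$, then $\chi$. For $i\neq j$, $f_{i_j}(g)$ ($g\in G_i$) is the class of the automorphism of $G$ which sends each $x\in G_j$ to $gxg^{-1}$ (i.e. conjugates $G_j$ by $g^{-1}$, where conjugation by $y$ is $x\mapsto y^{-1}xy$) and fixes every $G_k$ with $k\ne j$ pointwise; $G_{i_j}=\{f_{i_j}(g):g\in G_i\}$, and $f_{i_j}:G_i\to G_{i_j}$ is an isomorphism. The group $\Phi=\prod_{i=1}^n\mathrm{Aut}(G_i)$ is identified with the group of (classes of) factor automorphisms, i.e. those $\varphi\in\mathrm{Aut}(G)$ restricting to an automorphism of each $G_i$; $\mathrm{Ad}_{G_i}(g)$ is regarded as an element of $\Phi$ (acting trivially on $G_k$, $k\neq i$). ''Generated by groups $K_1,\dots,K_r$ subject to relations $R$'' means: the natural homomorphism from the quotient of the free product $K_1\ast\dots\ast K_r$ by the normal closure of $R$ is an isomorphism onto the group in question. *)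

(* Defs.v *)
From HB Require Import structures.
From mathcomp Require Import all_boot.
From mathcomp Require Import boolp classical_sets.

Set Implicit Arguments.
Unset Strict Implicit.
Unset Printing Implicit Defensive.

Local Open Scope quotient_scope.
Local Open Scope classical_set_scope.
Local Open Scope group_scope.

Section GroupMorphisms.
Variables (A B : groupType) (f : {multiplicative A -> B}).

Lemma hom1 : f 1 = 1.
Proof. by apply: (mulgI (f 1)); rewrite -gmulfM !mulg1. Qed.

Lemma homV x : f x^-1 = (f x)^-1.
Proof. by apply: (mulgI (f x)); rewrite -gmulfM !mulgV hom1. Qed.

Lemma homJ x y : f (x ^ y) = f x ^ f y.
Proof. by rewrite !conjgE !gmulfM homV. Qed.

End GroupMorphisms.

(* Subgroups are boolean predicates; classically this is no restriction. *)
Record subgrp (G : groupType) (H : groupClosed G) :=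
  Subgrp { incl :> G; inclP : incl \in H }.

Section Subgroup.
Variables (G : groupType) (H : groupClosed G).

Fact subgrp_closed : group_closed (fun x : G => x \in H).
Proof.
split; first exact: gpred1.
by move=> x y xH yH; rewrite unfold_in; apply: gpredM => //; apply: gpredVr.
Qed.

HB.instance Definition _ := [isSub of subgrp H for @incl G H].
HB.instance Definition _ := [Choice of subgrp H by <:].
HB.instance Definition _ :=
  SubChoice_isSubGroup.Build G (fun x : G => x \in H) (subgrp H) subgrp_closed.

Fact incl_morph : {morph @incl G H : x y / x * y}. Proof. exact: valM. Qed.
HB.instance Definition _ :=
  isMultiplicative.Build (subgrp H) G (@incl G H) incl_morph.

End Subgroup.

HB.mixin Record isConjClosed (G : groupType) (S : {pred G}) := {
  gpredJr : forall x y : G, x \in S -> x ^ y \in S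
}.

#[short(type="normalClosed")]
HB.structure Definition NormalClosed G := {S of GroupClosed G S & isConjClosed G S}.

Section Image.
Variables (A B : groupType) (f : {multiplicative A -> B}).

Definition himage : {pred B} := fun y => `[< exists x, y = f x >].

Fact himage1 : 1 \in himage.
Proof. by apply/asboolP; exists 1; rewrite hom1. Qed.

Fact himageM : mulg_closed himage.
Proof.
move=> _ _ /asboolP[x ->] /asboolP[y ->].
by apply/asboolP; exists (x * y); rewrite gmulfM.
Qed.

Fact himageV : invg_closed himage.
Proof. by move=> _ /asboolP[x ->]; apply/asboolP; exists x^-1; rewrite homV. Qed.

HB.instance Definition _ := isMulClosed.Build B himage himageM.
HB.instance Definition _ := isMul1Closed.Build B himage himage1.
HB.instance Definition _ := isInvClosed.Build B himage himageV.

Fact mem_himage x : f x \in himage.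
Proof. by apply/asboolP; exists x. Qed.

Definition corestr x : subgrp himage := Subgrp (mem_himage x).

Fact corestr_morph : {morph corestr : x y / x * y}.
Proof. by move=> x y; apply/val_inj; rewrite valM /= gmulfM. Qed.
HB.instance Definition _ :=
  isMultiplicative.Build A (subgrp himage) corestr corestr_morph.

End Image.

Section Quotient.
Variables (G : groupType) (N : normalClosed G).

Definition coset_rel : rel G := fun x y => x / y \in N.

Fact coset_rel_refl : reflexive coset_rel.
Proof. by move=> x; rewrite /coset_rel mulgV gpred1. Qed.

Fact coset_rel_sym : symmetric coset_rel.
Proof.
suff h x y : coset_rel x y -> coset_rel y x by move=> x y; apply/idP/idP; apply: h.
by rewrite /coset_rel => /gpredVr; rewrite invgF.
Qed.

Fact coset_rel_trans : transitive coset_rel.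
Proof.
by move=> y x z xy yz; have := gpredM _ _ xy yz; rewrite /coset_rel divgKA.
Qed.

Canonical coset_equiv := EquivRel coset_rel coset_rel_refl coset_rel_sym coset_rel_trans.

Definition quotg := {eq_quot coset_rel}.
HB.instance Definition _ := Choice.on quotg.
HB.instance Definition _ := EqQuotient.on quotg.

Definition qproj (x : G) : quotg := \pi_quotg x.

Lemma qprojP x y : reflect (qproj x = qproj y) (x / y \in N).
Proof. by rewrite -[_ \in _]/(coset_rel x y); apply/(iffP idP) => /eqmodP. Qed.

Lemma qprojW (P : quotg -> Prop) : (forall x, P (qproj x)) -> forall c, P c.
Proof. exact: quotW. Qed.

Lemma qreprK (c : quotg) : qproj (repr c) = c.
Proof. exact: reprK. Qed.

Definition quotg_mul (c d : quotg) : quotg := qproj (repr c * repr d).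
Definition quotg_inv (c : quotg) : quotg := qproj (repr c)^-1.

Lemma qprojM_subproof x y : quotg_mul (qproj x) (qproj y) = qproj (x * y).
Proof.
apply/qprojP.
have /qprojP hx := qreprK (qproj x); have /qprojP hy := qreprK (qproj y).
set a := repr _ in hx *; set b := repr _ in hy *.
have -> : a * b / (x * y) = (a / x) * (b / y) ^ x^-1.
  by rewrite invgM conjgE invgK !mulgA mulgVK.
by apply: gpredM => //; apply: gpredJr.
Qed.

Lemma qprojV_subproof x : quotg_inv (qproj x) = qproj x^-1.
Proof.
apply/qprojP; have /qprojP := qreprK (qproj x); set a := repr _ => /gpredVr hx.
have -> : a^-1 / x^-1 = (a / x)^-1 ^ x by rewrite invgF conjgE !invgK !mulgA mulVg mul1g.
exact: gpredJr.
Qed.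

Fact quotg_mulA : associative quotg_mul.
Proof.
elim/qprojW=> x; elim/qprojW=> y; elim/qprojW=> z.
by rewrite !qprojM_subproof mulgA.
Qed.

Fact quotg_mul1 : left_id (qproj 1) quotg_mul.
Proof. by elim/qprojW=> x; rewrite qprojM_subproof mul1g. Qed.

Fact quotg_1mul : right_id (qproj 1) quotg_mul.
Proof. by elim/qprojW=> x; rewrite qprojM_subproof mulg1. Qed.

Fact quotg_Vmul : left_inverse (qproj 1) quotg_inv quotg_mul.
Proof. by elim/qprojW=> x; rewrite qprojV_subproof qprojM_subproof mulVg. Qed.

Fact quotg_mulV : right_inverse (qproj 1) quotg_inv quotg_mul.
Proof. by elim/qprojW=> x; rewrite qprojV_subproof qprojM_subproof mulgV. Qed.

HB.instance Definition _ := isGroup.Build quotg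
  quotg_mulA quotg_mul1 quotg_1mul quotg_Vmul quotg_mulV.

Fact qproj_morph : {morph qproj : x y / x * y}.
Proof. by move=> x y; rewrite -qprojM_subproof. Qed.
HB.instance Definition _ := isMultiplicative.Build G quotg qproj qproj_morph.

End Quotient.

Section NormalClosure.
Variables (G : groupType) (R : G -> Prop).

Inductive in_normal_closure : G -> Prop :=
| ncl_gen x of R x : in_normal_closure x
| ncl_one : in_normal_closure 1
| ncl_mul x y of in_normal_closure x & in_normal_closure y :
    in_normal_closure (x * y)
| ncl_inv x of in_normal_closure x : in_normal_closure x^-1
| ncl_conj x y of in_normal_closure x : in_normal_closure (x ^ y).

Definition normal_closure : {pred G} := fun x => `[< in_normal_closure x >].

Fact normal_closure1 : 1 \in normal_closure.
Proof. exact/asboolP/ncl_one. Qed.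

Fact normal_closureM : mulg_closed normal_closure.
Proof. by move=> x y /asboolP hx /asboolP hy; apply/asboolP/ncl_mul. Qed.

Fact normal_closureV : invg_closed normal_closure.
Proof. by move=> x /asboolP hx; apply/asboolP/ncl_inv. Qed.

Fact normal_closureJ x y : x \in normal_closure -> x ^ y \in normal_closure.
Proof. by move=> /asboolP hx; apply/asboolP/ncl_conj. Qed.

HB.instance Definition _ := isMulClosed.Build G normal_closure normal_closureM.
HB.instance Definition _ := isMul1Closed.Build G normal_closure normal_closure1.
HB.instance Definition _ := isInvClosed.Build G normal_closure normal_closureV.
HB.instance Definition _ := isConjClosed.Build G normal_closure normal_closureJ.

End NormalClosure.

Definition dprod (I : finType) (K : I -> groupType) := {dffun forall i, K i}.

Section DirectProduct.
Variables (I : finType) (K : I -> groupType).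

HB.instance Definition _ := Choice.on (dprod K).

Definition dprod_one : dprod K := [ffun i => 1].
Definition dprod_mul (a b : dprod K) : dprod K := [ffun i => a i * b i].
Definition dprod_inv (a : dprod K) : dprod K := [ffun i => (a i)^-1].

Fact dprod_mulA : associative dprod_mul.
Proof. by move=> a b c; apply/ffunP => i; rewrite !ffunE mulgA. Qed.
Fact dprod_mul1 : left_id dprod_one dprod_mul.
Proof. by move=> a; apply/ffunP => i; rewrite !ffunE mul1g. Qed.
Fact dprod_1mul : right_id dprod_one dprod_mul.
Proof. by move=> a; apply/ffunP => i; rewrite !ffunE mulg1. Qed.
Fact dprod_Vmul : left_inverse dprod_one dprod_inv dprod_mul.
Proof. by move=> a; apply/ffunP => i; rewrite !ffunE mulVg. Qed.
Fact dprod_mulV : right_inverse dprod_one dprod_inv dprod_mul.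
Proof. by move=> a; apply/ffunP => i; rewrite !ffunE mulgV. Qed.

HB.instance Definition _ := isGroup.Build (dprod K)
  dprod_mulA dprod_mul1 dprod_1mul dprod_Vmul dprod_mulV.

End DirectProduct.

Section FreeProduct.
Variables (I : choiceType) (K : I -> groupType).

Definition word := seq {i : I & K i}.
Definition letter i (a : K i) : {i : I & K i} := Tagged K a.

(* The least congruence on the free monoid of words that identifies a letter 1
   with the empty word and multiplies adjacent letters of the same factor. *)
Inductive weq : word -> word -> Prop :=
| weq_refl u : weq u u
| weq_sym u v of weq u v : weq v u
| weq_trans u v w of weq u v & weq v w : weq u w
| weq_cat u u' v v' of weq u u' & weq v v' : weq (u ++ v) (u' ++ v')
| weq_one i : weq [:: letter (1 : K i)] [::]
| weq_mul i (a b : K i) : weq [:: letter a; letter b] [:: letter (a * b)].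

Definition weqb : rel word := fun u v => `[< weq u v >].

Fact weqb_refl : reflexive weqb. Proof. by move=> u; apply/asboolP/weq_refl. Qed.
Fact weqb_sym : symmetric weqb.
Proof. by move=> u v; apply/asboolP/asboolP; apply: weq_sym. Qed.
Fact weqb_trans : transitive weqb.
Proof.
by move=> v u w /asboolP uv /asboolP vw; apply/asboolP; apply: weq_trans uv vw.
Qed.

Canonical weqb_equiv := EquivRel weqb weqb_refl weqb_sym weqb_trans.

Definition fprod := {eq_quot weqb}.
HB.instance Definition _ := Choice.on fprod.
HB.instance Definition _ := EqQuotient.on fprod.

Definition wclass (u : word) : fprod := \pi_fprod u.

Lemma wclassP u v : wclass u = wclass v <-> weq u v.
Proof. by split=> [/eqmodP/asboolP|h]; last by apply/eqmodP/asboolP. Qed.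

Lemma wclassW (P : fprod -> Prop) : (forall u, P (wclass u)) -> forall x, P x.
Proof. exact: quotW. Qed.

Lemma wreprK (x : fprod) : wclass (repr x) = x. Proof. exact: reprK. Qed.

Definition winv (u : word) : word :=
  rev [seq let: existT i a := l in letter a^-1 | l <- u].

Definition fprod_mul (x y : fprod) : fprod := wclass (repr x ++ repr y).
Definition fprod_inv (x : fprod) : fprod := wclass (winv (repr x)).

Lemma wclassM u v : fprod_mul (wclass u) (wclass v) = wclass (u ++ v).
Proof. by apply/wclassP; apply: weq_cat; apply/wclassP; apply: wreprK. Qed.

Lemma winv_cat u v : winv (u ++ v) = winv v ++ winv u.
Proof. by rewrite /winv map_cat rev_cat. Qed.

Lemma winv_weq u v : weq u v -> weq (winv u) (winv v).
Proof.
elim=> {u v} [u|u v _|u v w _ + _|u u' v v' _ hu _ hv|i|i a b].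
- exact: weq_refl.
- exact: weq_sym.
- exact: weq_trans.
- by rewrite !winv_cat; apply: weq_cat.
- by rewrite /winv /= /rev /= invg1; apply: weq_one.
- by rewrite /winv /= /rev /= invgM; apply: weq_mul.
Qed.

Lemma wclassV u : fprod_inv (wclass u) = wclass (winv u).
Proof. by apply/wclassP/winv_weq/wclassP/wreprK. Qed.

Fact fprod_mulA : associative fprod_mul.
Proof.
by elim/wclassW=> u; elim/wclassW=> v; elim/wclassW=> w; rewrite !wclassM catA.
Qed.
Fact fprod_mul1 : left_id (wclass [::]) fprod_mul.
Proof. by elim/wclassW=> u; rewrite wclassM. Qed.
Fact fprod_1mul : right_id (wclass [::]) fprod_mul.
Proof. by elim/wclassW=> u; rewrite wclassM cats0. Qed.

Lemma winvK u : winv (winv u) = u.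
Proof.
rewrite /winv map_rev revK -map_comp -[RHS]map_id; apply: eq_map => -[i a] /=.
by rewrite /letter /= invgK.
Qed.

Fact fprod_mulV : right_inverse (wclass [::]) fprod_inv fprod_mul.
Proof.
elim/wclassW=> u; rewrite wclassV wclassM; apply/wclassP.
elim: u => [|[i a] u IHu]; first exact: weq_refl.
rewrite -cat1s winv_cat -!catA [u ++ _]catA.
apply: (@weq_trans _ ([:: letter a] ++ ([::] ++ winv [:: letter a]))).
  by apply: weq_cat (weq_refl _) _; apply: weq_cat IHu (weq_refl _).
rewrite /winv /= /rev /=.
by apply: weq_trans (weq_mul _ _) _; rewrite mulgV; apply: weq_one.
Qed.

Fact fprod_Vmul : left_inverse (wclass [::]) fprod_inv fprod_mul.
Proof.
elim/wclassW=> u; have := fprod_mulV (wclass (winv u)).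
by rewrite !wclassV winvK.
Qed.

HB.instance Definition _ := isGroup.Build fprod
  fprod_mulA fprod_mul1 fprod_1mul fprod_Vmul fprod_mulV.

Definition fpin i (a : K i) : fprod := wclass [:: letter a].

Fact fpin_morph i : {morph @fpin i : a b / a * b}.
Proof.
move=> a b; rewrite -[RHS]/(fprod_mul _ _) wclassM.
by apply/wclassP/weq_sym/weq_mul.
Qed.
HB.instance Definition _ i :=
  isMultiplicative.Build (K i) fprod (@fpin i) (@fpin_morph i).

Section Lift.
Variables (H : groupType) (h : forall i, {multiplicative K i -> H}).

Definition weval (u : word) : H := \prod_(l <- u) h (tag l) (tagged l).

Definition fplift (x : fprod) : H := weval (repr x).

Lemma weval_weq u v : weq u v -> weval u = weval v.
Proof.
elim=> {u v} [u|u v _|u v w _ -> _ ->|u u' v v' _ hu _ hv|i|i a b] //.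
- by rewrite /weval !big_cat /= -/(weval u) -/(weval v) hu hv.
- by rewrite /weval big_seq1 big_nil /= hom1.
- by rewrite /weval big_cons !big_seq1 /= gmulfM.
Qed.

Lemma fplift_wclass u : fplift (wclass u) = weval u.
Proof. exact/weval_weq/wclassP/wreprK. Qed.

Fact fplift_morph : {morph fplift : x y / x * y}.
Proof.
elim/wclassW=> u; elim/wclassW=> v; rewrite -[_ * _ in LHS]/(fprod_mul _ _).
by rewrite wclassM !fplift_wclass /weval big_cat.
Qed.
HB.instance Definition _ := isMultiplicative.Build fprod H fplift fplift_morph.

Lemma fplift_in i (a : K i) : fplift (fpin a) = h i a.
Proof. by rewrite fplift_wclass /weval big_seq1. Qed.

End Lift.

Lemma fprod_hom_ext (H : groupType) (f g : {multiplicative fprod -> H}) :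
  (forall i (a : K i), f (fpin a) = g (fpin a)) -> f =1 g.
Proof.
move=> fg; elim/wclassW; elim=> [|[i a] u IHu]; first by rewrite !hom1.
have -> : wclass (existT K i a :: u) = fpin a * wclass u.
  by rewrite -[RHS]/(fprod_mul _ _) wclassM.
by rewrite !gmulfM fg IHu.
Qed.

End FreeProduct.

(* [H] is generated by the groups [K i], each sent to [H] by [h i], subject to
   the relations [x = y] for [R x y]: the homomorphism induced by the [h i] on
   the quotient of the free product of the [K i] is an isomorphism onto [H]. *)
Definition presents (I : choiceType) (K : I -> groupType) (H : groupType)
    (h : forall i, {multiplicative K i -> H}) (R : fprod K -> fprod K -> Prop) :=
  exists psi : {multiplicative
      quotg (normal_closure (fun r => exists x y, R x y /\ r = x / y)) -> H},
    (forall x, psi (qproj _ x) = fplift h x) /\ bijective psi.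

Record aut (G : groupType) := Aut {
  autf :> G -> G;
  autfV : G -> G;
  autf_morph : {morph autf : x y / x * y};
  autfK : cancel autf autfV;
  autfVK : cancel autfV autf
}.

Section Automorphisms.
Variable G : groupType.

HB.instance Definition _ := gen_eqMixin (aut G).
HB.instance Definition _ := gen_choiceMixin (aut G).
HB.instance Definition _ (f : aut G) :=
  isMultiplicative.Build G G f (autf_morph f).

Lemma autP (f g : aut G) : f =1 g -> f = g.
Proof.
case: f => f f' fM fK f'K; case: g => g g' gM gK g'K /= fg.
have {}fg : f = g by apply/funext.
subst g; have fg' : f' = g' by apply/funext => x; rewrite -[x in LHS]g'K fK.
by subst g'; congr Aut; apply: Prop_irrelevance.
Qed.

Definition aut_one : aut G :=
  @Aut G id id (fun _ _ => erefl) (fun=> erefl) (fun=> erefl).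

Fact aut_inv_morph (f : aut G) : {morph autfV f : x y / x * y}.
Proof.
by move=> x y; apply: (can_inj (autfK f)); rewrite autf_morph !autfVK.
Qed.

Definition aut_inv (f : aut G) : aut G :=
  Aut (aut_inv_morph f) (autfVK f) (autfK f).

Fact aut_mul_morph (f g : aut G) : {morph g \o f : x y / x * y}.
Proof. by move=> x y /=; rewrite !autf_morph. Qed.

(* Automorphisms act on the right: [f * g] is [f] followed by [g]. *)
Definition aut_mul (f g : aut G) : aut G :=
  Aut (aut_mul_morph f g)
      (can_comp (autfK g) (autfK f)) (can_comp (autfVK f) (autfVK g)).

Fact aut_mulA : associative aut_mul. Proof. by move=> f g h; apply: autP. Qed.
Fact aut_mul1 : left_id aut_one aut_mul. Proof. by move=> f; apply: autP. Qed.
Fact aut_1mul : right_id aut_one aut_mul. Proof. by move=> f; apply: autP. Qed.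
Fact aut_Vmul : left_inverse aut_one aut_inv aut_mul.
Proof. by move=> f; apply: autP => x /=; rewrite autfVK. Qed.
Fact aut_mulV : right_inverse aut_one aut_inv aut_mul.
Proof. by move=> f; apply: autP => x /=; rewrite autfK. Qed.

HB.instance Definition _ := isGroup.Build (aut G)
  aut_mulA aut_mul1 aut_1mul aut_Vmul aut_mulV.

Lemma autE_mul (f g : aut G) x : (f * g) x = g (f x). Proof. by []. Qed.
Lemma autE_one x : (1 : aut G) x = x. Proof. by []. Qed.

Fact inn_morph g : {morph (fun x : G => x ^ g) : x y / x * y}.
Proof. by move=> x y; rewrite conjMg. Qed.

Definition inn (g : G) : aut G :=
  @Aut G (fun x => x ^ g) (fun x => x ^ g^-1) (inn_morph g) (conjgK g) (conjgKV g).

Definition Inn : {pred aut G} := fun f => `[< exists g, f = inn g >].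

Fact Inn1 : 1 \in Inn.
Proof. by apply/asboolP; exists 1; apply: autP => x /=; rewrite conjg1. Qed.

Fact InnM : mulg_closed Inn.
Proof.
move=> _ _ /asboolP[g ->] /asboolP[h ->]; apply/asboolP; exists (g * h).
by apply: autP => x; rewrite autE_mul /= conjgM.
Qed.

Fact InnV : invg_closed Inn.
Proof.
move=> _ /asboolP[g ->]; apply/asboolP; exists g^-1.
by apply: autP.
Qed.

Fact InnJ f h : f \in Inn -> f ^ h \in Inn.
Proof.
move=> /asboolP[g ->]; apply/asboolP; exists (h g).
apply: autP => x; rewrite !autE_mul [LHS]homJ; congr (_ ^ _).
exact: autfVK.
Qed.

HB.instance Definition _ := isMulClosed.Build (aut G) Inn InnM.
HB.instance Definition _ := isMul1Closed.Build (aut G) Inn Inn1.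
HB.instance Definition _ := isInvClosed.Build (aut G) Inn InnV.
HB.instance Definition _ := isConjClosed.Build (aut G) Inn InnJ.

Definition Out := quotg Inn.
HB.instance Definition _ := Group.on Out.

End Automorphisms.

Section PureSymmetric.
Variables (G : groupType) (n : nat) (Gi : 'I_n -> groupClosed G).

Definition pure_sym (psi : aut G) :=
  forall i, exists g, psi @` [set` Gi i] = [set x ^ g | x in [set` Gi i]].

Definition pureOut_pred : {pred Out G} :=
  fun c => `[< exists psi : aut G, c = qproj _ psi /\ pure_sym psi >].

Fact pureOut1 : 1 \in pureOut_pred.
Proof.
apply/asboolP; exists 1; split; first by rewrite hom1.
by move=> i; exists 1; apply: eq_imagel => x _; rewrite conjg1.
Qed.

Fact pureOutM : mulg_closed pureOut_pred.
Proof.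
move=> _ _ /asboolP[p [-> hp]] /asboolP[q [-> hq]].
apply/asboolP; exists (p * q); split; first by rewrite gmulfM.
move=> i; have [g hg] := hp i; have [h hh] := hq i; exists (h * q g).
rewrite -[LHS]/((q \o p) @` _) -image_comp hg image_comp.
have -> : (q \o (fun x => x ^ g)) @` [set` Gi i] = (fun x => x ^ q g) @` (q @` [set` Gi i]).
  rewrite image_comp; apply: eq_imagel => x _ /=.
  exact: homJ.
by rewrite hh image_comp; apply: eq_imagel => x _ /=; rewrite conjgM.
Qed.

Fact pureOutV : invg_closed pureOut_pred.
Proof.
move=> _ /asboolP[p [-> hp]]; apply/asboolP; exists p^-1; split; first by rewrite homV.
move=> i; have [g hg] := hp i; exists (p^-1 g)^-1.
have pK x : p^-1 (p x) = x by rewrite -autE_mul mulgV.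
have h2 : [set` Gi i] = (fun x => p^-1 x ^ p^-1 g) @` [set` Gi i].
  have : p^-1 @` (p @` [set` Gi i]) = p^-1 @` ((fun x => x ^ g) @` [set` Gi i]).
    by rewrite hg.
  rewrite !image_comp.
  have -> : (p^-1 \o p) @` [set` Gi i] = [set` Gi i].
    by rewrite -[RHS]image_id; apply: eq_imagel => x _; apply: pK.
  by move=> {1}->; apply: eq_imagel => x _; apply: homJ.
rewrite [in RHS]h2 image_comp; apply: eq_imagel => x _ /=.
by rewrite conjgK.
Qed.

HB.instance Definition _ := isMulClosed.Build (Out G) pureOut_pred pureOutM.
HB.instance Definition _ := isMul1Closed.Build (Out G) pureOut_pred pureOut1.
HB.instance Definition _ := isInvClosed.Build (Out G) pureOut_pred pureOutV.

Definition pureOut := subgrp pureOut_pred.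
HB.instance Definition _ := Group.on pureOut.

Definition pure_class (psi : aut G) (h : pure_sym psi) : pureOut :=
  @Subgrp (Out G) pureOut_pred (qproj _ psi)
    (introT (asboolP _) (ex_intro _ psi (conj erefl h))).

End PureSymmetric.

(* The homomorphism from the free product of the [Gi i] to [G] induced by the
   inclusions is bijective. *)
Definition free_splitting (G : groupType) (n : nat) (Gi : 'I_n -> groupClosed G) :=
  bijective (fplift (fun i => @incl G (Gi i) : {multiplicative subgrp (Gi i) -> G})).

Section FreeSplitting.
Variables (G : groupType) (n : nat) (Gi : 'I_n -> groupClosed G).
Hypothesis spl : free_splitting Gi.

Notation nat_hom :=
  (fplift (fun i => @incl G (Gi i) : {multiplicative subgrp (Gi i) -> G})).

Fact split_inv_subproof : exists f, cancel f nat_hom.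
Proof. by case: spl => f _ fK; exists f. Qed.

Definition split_inv : G -> fprod (fun i => subgrp (Gi i)) :=
  sval (cid split_inv_subproof).

Lemma split_invK : cancel split_inv nat_hom.
Proof. exact: svalP (cid split_inv_subproof). Qed.

Lemma split_inv_morph : {morph split_inv : x y / x * y}.
Proof.
by move=> x y; apply: (bij_inj spl); rewrite fplift_morph !split_invK.
Qed.
HB.instance Definition _ := isMultiplicative.Build _ _ split_inv split_inv_morph.

Lemma split_inv_incl i (x : subgrp (Gi i)) : split_inv (incl x) = fpin x.
Proof. by apply: (bij_inj spl); rewrite split_invK fplift_in. Qed.

Lemma split_hom_ext (H : groupType) (f g : {multiplicative G -> H}) :
  (forall i (x : subgrp (Gi i)), f (incl x) = g (incl x)) -> f =1 g.
Proof.
move=> fg x; rewrite -(split_invK x).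
apply: (@fprod_hom_ext _ _ _ (f \o nat_hom) (g \o nat_hom)) => i a.
have e : nat_hom (fpin a) = incl a by rewrite fplift_in.
by rewrite -[LHS]/(f (nat_hom (fpin a))) -[RHS]/(g (nat_hom (fpin a))) e.
Qed.

Definition glue (H : groupType) (h : forall i, {multiplicative subgrp (Gi i) -> H}) :
  {multiplicative G -> H} := fplift h \o split_inv.

Lemma glue_incl (H : groupType) (h : forall i, {multiplicative subgrp (Gi i) -> H})
  i (x : subgrp (Gi i)) : glue h (incl x) = h i x.
Proof. by rewrite /= split_inv_incl fplift_in. Qed.

Section PartialConjugation.
Variables (i j : 'I_n).

(* Conjugation by [g^-1] (in the convention [x ^ y = y^-1 x y]) on the factor [j],
   identity on the other factors. *)
Definition pconj_at (g : subgrp (Gi i)) k (x : subgrp (Gi k)) : G :=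
  if k == j then incl g * incl x * (incl g)^-1 else incl x.

Fact pconj_at_morph g k : {morph @pconj_at g k : x y / x * y}.
Proof.
move=> x y; rewrite /pconj_at; case: eqP => _; rewrite gmulfM //.
by rewrite !mulgA mulgVK.
Qed.
HB.instance Definition _ g k :=
  isMultiplicative.Build (subgrp (Gi k)) G (@pconj_at g k) (@pconj_at_morph g k).

Definition pconj_fun (g : subgrp (Gi i)) : {multiplicative G -> G} :=
  glue (fun k => @pconj_at g k : {multiplicative subgrp (Gi k) -> G}).

Hypothesis ij : i != j.

Lemma pconj_fun_incl g k (x : subgrp (Gi k)) :
  pconj_fun g (incl x) =
  if k == j then incl g * incl x * (incl g)^-1 else incl x.
Proof. exact: glue_incl. Qed.

Lemma pconj_funM g h : pconj_fun h \o pconj_fun g =1 pconj_fun (g * h).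
Proof.
apply: (split_hom_ext (f := pconj_fun h \o pconj_fun g)) => k x.
rewrite -[LHS]/(pconj_fun h (pconj_fun g (incl x))) !pconj_fun_incl.
case: ifP => kj; last by rewrite pconj_fun_incl kj.
rewrite !gmulfM homV !pconj_fun_incl (negPf ij) kj.
by rewrite invgM !mulgA.
Qed.

Lemma pconj_fun1 : pconj_fun 1 =1 id.
Proof.
apply: (split_hom_ext (g := idfun)) => k x; rewrite pconj_fun_incl.
by case: eqP => // _; rewrite hom1 invg1 mul1g mulg1.
Qed.

Fact pconj_funK g : cancel (pconj_fun g) (pconj_fun g^-1).
Proof. by move=> x; rewrite [LHS](pconj_funM g g^-1) mulgV pconj_fun1. Qed.

Fact pconj_funVK g : cancel (pconj_fun g^-1) (pconj_fun g).
Proof. by move=> x; rewrite [LHS](pconj_funM g^-1 g) mulVg pconj_fun1. Qed.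

Definition pconj (g : subgrp (Gi i)) : aut G :=
  Aut (fun x y => gmulfM (s := pconj_fun g) x y) (pconj_funK g) (pconj_funVK g).

Lemma pconj_incl g k (x : subgrp (Gi k)) :
  pconj g (incl x) = if k == j then incl g * incl x * (incl g)^-1 else incl x.
Proof. exact: pconj_fun_incl. Qed.

Lemma pconjM : {morph pconj : g h / g * h}.
Proof. by move=> g h; apply: autP => x; rewrite -[LHS]pconj_funM. Qed.

Fact pconj_pure_sym g : pure_sym Gi (pconj g).
Proof.
move=> k; exists (if k == j then (incl g)^-1 else 1).
apply: eq_imagel => x xk; rewrite -[x]/(incl (Subgrp xk)) pconj_incl.
by case: eqP => _; rewrite ?conjg1 // conjgE invgK mulgA.
Qed.

Definition pconj_class (g : subgrp (Gi i)) : pureOut Gi :=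
  pure_class (pconj_pure_sym g).

Fact pconj_class_morph : {morph pconj_class : g h / g * h}.
Proof.
by move=> g h; apply/val_inj; rewrite valM /= pconjM gmulfM.
Qed.
HB.instance Definition _ :=
  isMultiplicative.Build (subgrp (Gi i)) (pureOut Gi) pconj_class pconj_class_morph.

End PartialConjugation.

(* The product of the groups [Aut (Gi i)], identified through [fact_class] below
   with the group of classes of factor automorphisms. *)
Definition Phi := dprod (fun i => aut (subgrp (Gi i))).
HB.instance Definition _ := Group.on Phi.

Definition fact_fun (phi : Phi) : {multiplicative G -> G} :=
  glue (fun i => @incl G (Gi i) \o phi i : {multiplicative subgrp (Gi i) -> G}).

Lemma fact_fun_incl phi i (x : subgrp (Gi i)) :
  fact_fun phi (incl x) = incl (phi i x).
Proof. exact: glue_incl. Qed.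

Lemma fact_funM phi chi : fact_fun chi \o fact_fun phi =1 fact_fun (phi * chi).
Proof.
apply: (split_hom_ext (f := fact_fun chi \o fact_fun phi)) => i x.
rewrite -[LHS]/(fact_fun chi (fact_fun phi (incl x))) !fact_fun_incl.
by rewrite ffunE.
Qed.

Lemma fact_fun1 : fact_fun 1 =1 id.
Proof.
by apply: (split_hom_ext (g := idfun)) => i x; rewrite fact_fun_incl ffunE.
Qed.

Fact fact_funK phi : cancel (fact_fun phi) (fact_fun phi^-1).
Proof. by move=> x; rewrite [LHS](fact_funM phi phi^-1) mulgV fact_fun1. Qed.

Fact fact_funVK phi : cancel (fact_fun phi^-1) (fact_fun phi).
Proof. by move=> x; rewrite [LHS](fact_funM phi^-1 phi) mulVg fact_fun1. Qed.

Definition fact_aut (phi : Phi) : aut G :=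
  Aut (fun x y => gmulfM (s := fact_fun phi) x y) (fact_funK phi) (fact_funVK phi).

Lemma fact_aut_incl phi i (x : subgrp (Gi i)) :
  fact_aut phi (incl x) = incl (phi i x).
Proof. exact: fact_fun_incl. Qed.

Lemma fact_autM : {morph fact_aut : phi chi / phi * chi}.
Proof. by move=> phi chi; apply: autP => x; rewrite -[LHS]fact_funM. Qed.

Fact fact_pure_sym phi : pure_sym Gi (fact_aut phi).
Proof.
move=> i; exists 1; apply/seteqP; split=> [_ [x xi <-]|_ [x xi <-]] /=.
  exists (fact_aut phi x); last exact: conjg1.
  have -> : fact_aut phi x = incl (phi i (Subgrp xi)).
    exact: (fact_aut_incl phi (Subgrp xi)).
  exact: inclP.
exists (incl (autfV (phi i) (Subgrp xi))); first exact: inclP.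
by apply: etrans (fact_aut_incl _ _) _; rewrite autfVK conjg1.
Qed.

Definition fact_class (phi : Phi) : pureOut Gi := pure_class (fact_pure_sym phi).

Fact fact_class_morph : {morph fact_class : phi chi / phi * chi}.
Proof. by move=> phi chi; apply/val_inj; rewrite valM /= fact_autM gmulfM. Qed.
HB.instance Definition _ :=
  isMultiplicative.Build Phi (pureOut Gi) fact_class fact_class_morph.

(* [Ad_(Gi i)(g)] on the factor [i], identity on the other factors. *)
Definition Ad i (g : subgrp (Gi i)) : Phi :=
  [ffun k => @dfwith _ (fun k => aut (subgrp (Gi k))) (fun k => 1) i (inn g) k].

(* The subgroup [G_(i_j)]; [f_(i_j)] is [corestr (pconj_class i j)]. *)
Definition Gij (i j : 'I_n) (ij : i != j) : groupType :=
  subgrp (himage (pconj_class ij : {multiplicative subgrp (Gi i) -> pureOut Gi})).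

(* [Some (i, j)] stands for the group [G_(i_j)] and [None] for [Phi]. *)
Definition gen_index := option {p : 'I_n * 'I_n | p.1 != p.2}.

Definition gen_group (k : gen_index) : groupType :=
  match k with
  | Some (exist _ ij) => Gij ij
  | None => Phi
  end.

Definition gen_hom (k : gen_index) : {multiplicative gen_group k -> pureOut Gi} :=
  match k return {multiplicative gen_group k -> pureOut Gi} with
  | Some (exist _ _) => @incl (pureOut Gi) _
  | None => fact_class
  end.

Definition genf (i j : 'I_n) (ij : i != j) (g : subgrp (Gi i)) : fprod gen_group :=
  @fpin _ gen_group (Some (exist (fun p => p.1 != p.2) (i, j) ij))
    (corestr (pconj_class ij) g).

Definition genphi (phi : Phi) : fprod gen_group := @fpin _ gen_group None phi.

Inductive pure_rel : fprod gen_group -> fprod gen_group -> Prop :=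
| pure_rel1 (i j k : 'I_n) (ij : i != j) (ik : i != k) (g h : subgrp (Gi i)) of j != k :
    pure_rel [~ genf ij g, genf ik h] 1
| pure_rel2 (i j k l : 'I_n) (ij : i != j) (kl : k != l)
    (g : subgrp (Gi i)) (h : subgrp (Gi k)) of uniq [:: i; j; k; l] :
    pure_rel [~ genf ij g, genf kl h] 1
| pure_rel3 (i j k : 'I_n) (ij : i != j) (ik : i != k) (jk : j != k)
    (g : subgrp (Gi j)) (h : subgrp (Gi i)) :
    pure_rel [~ genf jk g, genf ij h * genf ik h] 1
| pure_rel4 (i : 'I_n) (v : 'I_n.-1 -> 'I_n) (iv : forall m, i != v m) (g : subgrp (Gi i))
    of injective v : (* so that v enumerates all indices other than i *)
    pure_rel (\prod_(m < n.-1) genf (iv m) g) (genphi (Ad g))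
| pure_rel5 (i j : 'I_n) (ij : i != j) (g : subgrp (Gi i)) (phi : Phi) :
    pure_rel ((genphi phi)^-1 * genf ij g * genphi phi) (genf ij (phi i g)).

End FreeSplitting.

(* Main.v *)
(** A pure symmetric automorphism psi sends G_i to u_i G_i u_i^-1 for a unique
    reduced word u_i that does not end in a letter of G_i; measure psi by the
    sum of the lengths of the u_i.  Precomposing psi with f_(i_j)(a) multiplies
    u_j on the left by psi(a) and changes no other u_k, and this lowers the
    measure exactly when it deletes a letter x of G_i from a factorisation
    u_j = u_i x h.  A ping-pong argument shows that some such move exists unless
    all u_i are empty, i.e. unless psi is a factor automorphism.

    Recording the moves in the presented group lifts psi to that group; the lift
    is independent of the chosen descent by local confluence.  Two descents with
    different targets, neither centred at the target of the other, commute
    (relations 1 and 2); otherwise u_k = u_i x r and u_j = u_k y h for some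
    i, j, k, and relation 3 closes a hexagon all of whose other vertices have
    smaller measure.  Relation 5 makes lifts compatible with Phi, and relation 4
    shows that inner automorphisms lift to 1, so the kernel is trivial. *)
From HB Require Import structures.
From mathcomp Require Import all_boot.
From mathcomp Require Import boolp classical_sets.
Require Import Defs.

Set Implicit Arguments.
Unset Strict Implicit.
Unset Printing Implicit Defensive.

Local Open Scope group_scope.

(** * Reduced words in free products *)

Section ReducedWords.
Variables (I : choiceType) (K : I -> groupType).
Implicit Types (u v w : word K) (l m : {i : I & K i}).

Definition starts i w : bool := if w is l :: _ then tag l == i else false.

Definition ends i w : bool := if w is l :: w' then tag (last l w') == i else false.

Fixpoint reduced w : bool :=
  if w is l :: w' then [&& tagged l != 1, ~~ starts (tag l) w' & reduced w']
  else true.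

Definition lhead i w : K i :=
  if w is l :: _ then tagged_as (letter (1 : K i)) l else 1.

Definition ltail i w : word K := if starts i w then behead w else w.

Definition lcons i (a : K i) w : word K := if a == 1 then w else letter a :: w.

(** Van der Waerden's action of a factor on reduced words; it yields normal forms without a
    confluence argument for rewriting. *)
Definition push i (a : K i) w : word K := lcons (a * lhead i w) (ltail i w).

Lemma ends_cat i u l v : ends i (u ++ l :: v) = ends i (l :: v).
Proof. by case: u => //= m u; rewrite last_cat. Qed.

Lemma lhead_letter i (a : K i) w : lhead i (letter a :: w) = a.
Proof. by rewrite /lhead tagged_asE. Qed.

Lemma ltail_letter i (a : K i) w : ltail i (letter a :: w) = w.
Proof. by rewrite /ltail /= eqxx. Qed.

Lemma lhead_starts i w : ~~ starts i w -> lhead i w = 1.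
Proof.
case: w => //= -[k b] w /= ki; rewrite /tagged_as /=.
by case: eqP => // E; rewrite E eqxx in ki.
Qed.

Lemma ltail_starts i w : ~~ starts i w -> ltail i w = w.
Proof. by rewrite /ltail => /negPf->. Qed.

Lemma starts_letter i w : starts i w -> w = letter (lhead i w) :: ltail i w.
Proof. by case: w => //= -[k b] w /= /eqP ki; subst k; rewrite tagged_asE /ltail /= eqxx. Qed.

Lemma lconsK i w : reduced w -> lcons (lhead i w) (ltail i w) = w.
Proof.
move=> rw; case: (boolP (starts i w)) => [/starts_letter E|sw]; last first.
  by rewrite lhead_starts // ltail_starts // /lcons eqxx.
by move: rw; rewrite {1}E /= => /and3P[h _ _]; rewrite /lcons (negPf h) -E.
Qed.

Lemma starts_ltail i w : reduced w -> ~~ starts i (ltail i w).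
Proof.
move=> rw; case: (boolP (starts i w)) => [/starts_letter E|sw]; last by rewrite ltail_starts.
by move: rw; rewrite {1}E /= => /and3P[].
Qed.

Lemma reduced_ltail i w : reduced w -> reduced (ltail i w).
Proof. by rewrite /ltail; case: ifP => // _; case: w => //= l w /and3P[]. Qed.

Lemma reduced_lcons i (a : K i) w : ~~ starts i w -> reduced w -> reduced (lcons a w).
Proof. by rewrite /lcons; case: eqP => //= /eqP -> -> ->. Qed.

Lemma lhead_lcons i (a : K i) w : ~~ starts i w -> lhead i (lcons a w) = a.
Proof.
by rewrite /lcons; case: eqP => [-> /lhead_starts //|_ _]; rewrite lhead_letter.
Qed.

Lemma ltail_lcons i (a : K i) w : ~~ starts i w -> ltail i (lcons a w) = w.
Proof.
by rewrite /lcons; case: eqP => [_ /ltail_starts //|_ _]; rewrite ltail_letter.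
Qed.

Lemma reduced_push i (a : K i) w : reduced w -> reduced (push a w).
Proof. by move=> rw; apply: reduced_lcons; [exact: starts_ltail|exact: reduced_ltail]. Qed.

Lemma push1 i w : reduced w -> push (1 : K i) w = w.
Proof. by move=> rw; rewrite /push mul1g lconsK. Qed.

Lemma pushM i (a b : K i) w : reduced w -> push a (push b w) = push (a * b) w.
Proof.
move=> rw; rewrite /push; have s := starts_ltail i rw.
by rewrite lhead_lcons // ltail_lcons // mulgA.
Qed.

Lemma size_push i (a : K i) w : (size (push a w) <= (size w).+1)%N.
Proof.
apply: (@leq_trans (size (ltail i w)).+1); first by rewrite /push /lcons; case: ifP.
by rewrite ltnS /ltail; case: ifP => //; rewrite size_behead leq_pred.
Qed.

Definition pushes u w : word K := foldr (fun l => push (tagged l)) w u.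

Lemma reduced_pushes u w : reduced w -> reduced (pushes u w).
Proof. by elim: u => //= l u IHu rw; apply: reduced_push; apply: IHu. Qed.

(** The generators of the congruence hold as identities of the action ([push1], [pushM]), which
    makes [nform] independent of the chosen word. *)
Lemma pushes_weq u v w : weq u v -> reduced w -> pushes u w = pushes v w.
Proof.
move=> uv; elim: uv w => {u v} [|u v _ IH|u v z _ IHu _ IHv|u u' v v' _ IHu _ IHv|i|i a b] w rw //.
- by rewrite IH.
- by rewrite IHu // IHv.
- by rewrite /pushes !foldr_cat -!/(pushes _ _) IHv // IHu // reduced_pushes.
- exact: push1.
- exact: pushM.
Qed.

Lemma weq_push i (a : K i) w : weq (push a w) (letter a :: w).
Proof.
have lconsE (b : K i) v : weq (lcons b v) (letter b :: v).
  rewrite /lcons; case: eqP => [->|_]; last exact: weq_refl.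
  exact/weq_sym/(weq_cat (weq_one K i) (weq_refl v)).
apply: weq_trans (lconsE _ _) _; case: (boolP (starts i w)) => [/starts_letter E|sw].
  rewrite [in X in weq _ X]E.
  exact/weq_sym/(weq_cat (weq_mul a (lhead i w)) (weq_refl (ltail i w))).
by rewrite lhead_starts // ltail_starts // mulg1; apply: weq_refl.
Qed.

Lemma weq_pushes u : weq (pushes u [::]) u.
Proof.
elim: u => [|[i a] u IHu]; first exact: weq_refl.
apply: weq_trans (weq_push _ _) _.
exact: (weq_cat (weq_refl [:: letter a]) IHu).
Qed.

Lemma pushes_reduced u : reduced u -> pushes u [::] = u.
Proof.
elim: u => //= -[i a] u IHu /= /and3P[a1 su ru]; rewrite IHu // /push.
by rewrite lhead_starts // ltail_starts // mulg1 /lcons (negPf a1).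
Qed.

Lemma size_pushes u : (size (pushes u [::]) <= size u)%N.
Proof. by elim: u => //= l u IHu; apply: leq_trans (size_push _ _) _. Qed.

Definition nform (x : fprod K) : word K := pushes (repr x) [::].

Lemma nform_reduced x : reduced (nform x).
Proof. exact: reduced_pushes. Qed.

Lemma nformK x : wclass (nform x) = x.
Proof. by rewrite -[RHS]wreprK; apply/wclassP/weq_pushes. Qed.

Lemma nform_wclass u : nform (wclass u) = pushes u [::].
Proof. by apply: pushes_weq => //; apply/wclassP/wreprK. Qed.

Lemma reduced_cat u l v :
  reduced (u ++ l :: v) =
  [&& reduced u, ~~ ends (tag l) u & reduced (l :: v)].
Proof.
elim: u => [|m u IHu] //=; rewrite IHu; case: u IHu => [|k u] IHu /=.
  by rewrite andbT [tag m == _]eq_sym.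
by rewrite -!andbA.
Qed.

(** Distinct tags keep the two marked letters from occupying the same position, so one prefix
    contains the other together with its marked letter. *)
Lemma eq_cat_cons u l v u' l' v' : tag l != tag l' -> u ++ l :: v = u' ++ l' :: v' ->
  (exists r, u' = u ++ l :: r /\ v = r ++ l' :: v') \/
  (exists r, u = u' ++ l' :: r /\ v' = r ++ l :: v).
Proof.
move=> ll'; elim: u u' => [|m u IHu] [|m' u'] /=.
- by case=> E _; rewrite E eqxx in ll'.
- by case=> <- ->; left; exists u'.
- by case=> -> <-; right; exists u.
case=> <- /IHu [[r [-> ->]]|[r [-> ->]]]; [left|right]; by exists r.
Qed.

End ReducedWords.

(** * Presentations *)

Section QuotientLift.
Variables (I : choiceType) (K : I -> groupType) (H : groupType).
Variables (h : forall i, {multiplicative K i -> H}) (R : fprod K -> fprod K -> Prop).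
Local Notation N := (normal_closure (fun r => exists x y, R x y /\ r = x / y)).

Lemma fpliftV x : fplift h x^-1 = (fplift h x)^-1.
Proof. exact: homV. Qed.

Lemma fpliftR x y : fplift h [~ x, y] = [~ fplift h x, fplift h y].
Proof. by rewrite !commgEl !conjgE !fplift_morph !fpliftV. Qed.

Hypothesis hR : forall x y, R x y -> fplift h x = fplift h y.

Lemma fplift_qproj x y : qproj N x = qproj N y -> fplift h x = fplift h y.
Proof.
move=> /qprojP/asboolP hxy; apply: divg1_eq; rewrite -fpliftV -fplift_morph.
elim: hxy => {x y} [_ [x [y [/hR E ->]]]||x y _ hx _ hy|x _ hx|x y _ hx].
- by rewrite fplift_morph fpliftV E mulgV.
- exact: hom1.
- by rewrite fplift_morph hx hy mulg1.
- by rewrite fpliftV hx invg1.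
- by rewrite conjgE !fplift_morph fpliftV hx mul1g mulVg.
Qed.

Definition quot_lift (c : quotg N) : H := fplift h (repr c).

Lemma quot_lift_qproj x : quot_lift (qproj N x) = fplift h x.
Proof. exact/fplift_qproj/qreprK. Qed.

Fact quot_lift_morph : {morph quot_lift : c d / c * d}.
Proof.
by elim/qprojW=> x; elim/qprojW=> y; rewrite -gmulfM !quot_lift_qproj fplift_morph.
Qed.
HB.instance Definition _ :=
  isMultiplicative.Build (quotg N) H quot_lift quot_lift_morph.

Lemma presents_intro : (forall x, fplift h x = 1 -> qproj N x = 1) ->
  (forall y, exists x, fplift h x = y) -> presents h R.
Proof.
move=> ker1 surj; exists quot_lift; split=> [x|]; first exact: quot_lift_qproj.
exists (fun y => qproj N (sval (cid (surj y)))) => [c|y]; last first.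
  exact: etrans (quot_lift_qproj _) (svalP (cid (surj y))).
elim/qprojW: c => x; case: cid => y /= E.
have {}E : fplift h y = fplift h x := etrans E (quot_lift_qproj x).
apply/divg1_eq; rewrite -homV -gmulfM; apply: ker1.
by rewrite fplift_morph fpliftV E mulgV.
Qed.

End QuotientLift.

(** * Automorphisms of a free splitting *)

Section Splitting.
Variables (G : groupType) (n : nat) (Gi : 'I_n -> groupClosed G).
Hypothesis spl : free_splitting Gi.

Local Notation K := (fun i => subgrp (Gi i)).
Local Notation W := (word K).
Implicit Types (u v w : W) (i j k : 'I_n) (x y : G) (psi : aut G).

(** * Normal forms of elements of [G] and shortest words in cosets of a factor *)

Definition ev u : G := weval (fun i => @incl G (Gi i) : {multiplicative K i -> G}) u.

Definition wd x : W := nform (split_inv spl x).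

Lemma ev_nil : ev [::] = 1.
Proof. exact: big_nil. Qed.

Lemma ev_cons i (a : K i) u : ev (letter a :: u) = incl a * ev u.
Proof. exact: big_cons. Qed.

Lemma ev_cat u v : ev (u ++ v) = ev u * ev v.
Proof. exact: big_cat. Qed.

Lemma wd_reduced x : reduced (wd x).
Proof. exact: nform_reduced. Qed.

Lemma wdK x : ev (wd x) = x.
Proof. by rewrite /ev -fplift_wclass /wd nformK split_invK. Qed.

Lemma split_inv_ev u : split_inv spl (ev u) = wclass u.
Proof. by apply: (bij_inj spl); rewrite split_invK fplift_wclass. Qed.

Lemma wd_ev u : reduced u -> wd (ev u) = u.
Proof. by move=> ru; rewrite /wd split_inv_ev nform_wclass pushes_reduced. Qed.

Lemma size_wd_ev u : (size (wd (ev u)) <= size u)%N.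
Proof. by rewrite /wd split_inv_ev nform_wclass size_pushes. Qed.

Lemma incl_eq1 i (a : K i) : (incl a == 1) = (a == 1).
Proof.
apply/eqP/eqP => [E|->]; last exact: hom1.
by apply: val_inj; rewrite -[LHS]/(incl a) E val1.
Qed.

Definition rtrim i u : W := if ends i u then take (size u).-1 u else u.

Lemma rtrim_rcons i (t : K i) u : rtrim i (rcons u (letter t)) = u.
Proof.
by rewrite /rtrim -cats1 ends_cat /= eqxx size_cat addn1 take_size_cat.
Qed.

Lemma endsP i u : ends i u -> exists v (t : K i), u = rcons v (letter t).
Proof.
case/lastP: u => // v [k t]; rewrite -cats1 ends_cat /= => /eqP ki; subst k.
by exists v, t; rewrite cats1.
Qed.

Lemma size_rtrim i u : (size (rtrim i u) <= size u)%N.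
Proof. by rewrite /rtrim; case: ifP => // _; rewrite size_take; case: ltnP => // /ltnW. Qed.

(* The shortest word representing an element of the coset [x G_i]. *)
Definition crep i x : W := rtrim i (wd x).

Lemma crepP i x :
  [/\ reduced (crep i x), ~~ ends i (crep i x) & exists t : K i, x = ev (crep i x) * incl t].
Proof.
have := wd_reduced x; have := wdK x; rewrite /crep; move: (wd x) => u <- ru.
case: (boolP (ends i u)) => [/endsP[v [t E]]|eu].
  rewrite E rtrim_rcons; move: ru; rewrite E -cats1 reduced_cat => /and3P[rv ev_ _].
  by split=> //; exists t; rewrite ev_cat ev_cons ev_nil mulg1.
by rewrite /rtrim (negPf eu); split=> //; exists 1; rewrite hom1 mulg1.
Qed.

(** Appending a letter [t != 1] keeps [u] reduced, and trimming removes exactly that letter; so the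
    trimmed word depends only on the coset. *)
Lemma crep_ev i (t : K i) u : reduced u -> ~~ ends i u -> crep i (ev u * incl t) = u.
Proof.
move=> ru eu; rewrite /crep; have [->|t1] := eqVneq t 1.
  by rewrite hom1 mulg1 wd_ev // /rtrim (negPf eu).
have -> : ev u * incl t = ev (rcons u (letter t)).
  by rewrite -cats1 ev_cat ev_cons ev_nil mulg1.
rewrite wd_ev; first exact: rtrim_rcons.
by rewrite -cats1 reduced_cat /= ru eu t1.
Qed.

Lemma crep_ev1 i u : reduced u -> ~~ ends i u -> crep i (ev u) = u.
Proof. by move=> ru eu; have := crep_ev 1 ru eu; rewrite hom1 mulg1. Qed.

Lemma crep_mulr i (t : K i) x : crep i (x * incl t) = crep i x.
Proof.
have [ru eu [t' {1}->]] := crepP i x.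
by rewrite -mulgA -gmulfM crep_ev.
Qed.

Lemma size_crep_ev i u : (size (crep i (ev u)) <= size u)%N.
Proof. exact: leq_trans (size_rtrim _ _) (size_wd_ev _). Qed.

(** * Conjugating words of a pure symmetric automorphism, and the norm *)

Definition is_rep psi i u :=
  [/\ reduced u, ~~ ends i u,
      forall a : K i, exists b : K i, psi (incl a) = incl b ^ (ev u)^-1
    & forall b : K i, exists a : K i, psi (incl a) = incl b ^ (ev u)^-1].

Lemma conjVE (x y : G) : x ^ y^-1 = y * x * y^-1.
Proof. by rewrite conjgE invgK mulgA. Qed.

Lemma is_rep_conj psi psi' i u g : is_rep psi i u ->
  (forall a : K i, psi' (incl a) = psi (incl a) ^ g^-1) ->
  is_rep psi' i (crep i (g * ev u)).
Proof.
move=> [_ _ h1 h2] h; have [rr er [t E]] := crepP i (g * ev u).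
set r := crep _ _ in rr er E *.
have F (b : K i) : (incl b ^ (ev u)^-1) ^ g^-1 = incl (b ^ t^-1) ^ (ev r)^-1.
  by rewrite -conjgM -invgM E invgM conjgM homJ homV.
split=> // [a|b]; first by have [b hb] := h1 a; exists (b ^ t^-1); rewrite h hb F.
by have [a ha] := h2 (b ^ t); exists a; rewrite h ha F conjgK.
Qed.

(** Changing [g^-1] inside its coset [g^-1 G_i] does not change the conjugate, so the shortest word
    of that coset serves. *)
Lemma pure_symP psi : pure_sym Gi psi <-> forall i, exists u, is_rep psi i u.
Proof.
split=> hp i; have [g hg] := hp i.
  exists (crep i (g^-1 * ev [::])).
  have [rr er [t E]] := crepP i (g^-1 * ev [::]); move: E; set r := crep _ _ in rr er *.
  rewrite ev_nil mulg1 => E; split=> // [a|b].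
    have : (psi @` [set` Gi i])%classic (psi (incl a)) by exists (incl a) => //; exact: inclP.
    rewrite hg => -[y yi <-]; exists (Subgrp yi ^ t^-1).
    by rewrite homJ homV -conjgM -invgM -E invgK.
  have : ((fun x => x ^ g) @` [set` Gi i])%classic (incl (b ^ t) ^ g).
    by exists (incl (b ^ t)) => //; exact: inclP.
  rewrite -hg => -[x xi hx]; exists (Subgrp xi); rewrite [LHS]hx.
  by rewrite -[g]invgK E homJ invgM conjgM conjgK.
case: hg => _ _ h1 h2; exists (ev g)^-1; apply/seteqP; split=> y [x xi <-].
  have [b hb] := h1 (Subgrp xi); exists (incl b); first exact: inclP.
  by rewrite -hb.
have [a ha] := h2 (Subgrp xi); exists (incl a); first exact: inclP.
by rewrite ha.
Qed.

Hypothesis Gi_neq1 : forall i : 'I_n, exists x : G, x \in Gi i /\ x <> 1.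

Lemma neq1_factor i : exists a : K i, a != 1.
Proof.
have [x [xi x1]] := Gi_neq1 i; exists (Subgrp xi); apply/eqP => E; apply: x1.
by rewrite -[x]/(incl (Subgrp xi)) E hom1.
Qed.

(** Malnormality of [G_i]. In [u b = a u] the left side is reduced and one letter longer than [u];
    so [u] does not start in [G_i], yet if [u] were non-empty its first letter would be [a]. *)
Lemma factor_conj_nil i (a b : K i) u : reduced u -> ~~ ends i u -> a != 1 ->
  incl b ^ (ev u)^-1 = incl a -> u = [::].
Proof.
move=> ru eu a1; rewrite conjVE => E.
have b1 : b != 1.
  by apply: contraNneq a1 => b1; rewrite -incl_eq1 -E b1 hom1 mulg1 mulgV.
have {}E : wd (ev u * incl b) = wd (incl a * ev u) by rewrite -E mulgVK.
have Eb : ev u * incl b = ev (rcons u (letter b)).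
  by rewrite -cats1 ev_cat ev_cons ev_nil mulg1.
rewrite Eb wd_ev in E; last by rewrite -cats1 reduced_cat /= ru eu b1.
rewrite -ev_cons /wd split_inv_ev nform_wclass /= pushes_reduced // /push in E.
have [su|su] := boolP (starts i u).
  have /(congr1 size) := starts_letter su => /= su'.
  have : (size (rcons u (letter b)) <= size u)%N.
    by rewrite E su' /lcons; case: ifP.
  by rewrite size_rcons ltnn.
move: E; rewrite lhead_starts // ltail_starts // mulg1 /lcons (negPf a1).
by case: (u) su => //= l v sl [E _]; rewrite E /= eqxx in sl.
Qed.

(** Non-triviality of the factors enters: [v^-1 u] conjugates a non-trivial element of [G_i] into
    [G_i], so it lies in [G_i] by malnormality, and the two cosets agree. *)
Lemma is_rep_uniq psi i u v : is_rep psi i u -> is_rep psi i v -> u = v.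
Proof.
move=> [ru eu hu _] [rv ev' hv _]; have [x x1] := neq1_factor i.
have [b hb] := hu x; have [c hc] := hv x.
have c1 : c != 1.
  apply: contraNneq x1 => c1; rewrite -incl_eq1; apply/eqP/(can_inj (autfK psi)).
  by rewrite hc c1 hom1 conj1g [RHS]hom1.
have [rr er [t E]] := crepP i ((ev v)^-1 * ev u); set r := crep _ _ in rr er E.
have r0 : r = [::].
  apply: (@factor_conj_nil i c (b ^ t^-1) r) => //.
  have : incl b ^ ((ev v)^-1 * ev u)^-1 = incl c.
    by rewrite invgM invgK conjgM -hb hc conjgKV.
  by rewrite E invgM conjgM homJ homV.
rewrite -(crep_ev1 ru eu) -(crep_ev t rv ev').
by move: E; rewrite r0 ev_nil mul1g => <-; rewrite mulVKg.
Qed.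

Definition rep psi i : W := xget [::] [set u | is_rep psi i u]%classic.

Lemma repE psi i u : is_rep psi i u -> rep psi i = u.
Proof.
move=> hu; apply: is_rep_uniq (hu).
by apply: (@xgetPex _ [::] [set u | is_rep psi i u]%classic); exists u.
Qed.

Lemma repP psi i : pure_sym Gi psi -> is_rep psi i (rep psi i).
Proof.
by move=> /pure_symP/(_ i)[u hu]; rewrite (repE hu).
Qed.

Definition norm psi : nat := \sum_(i < n) size (rep psi i).

Lemma norm_lt psi psi' i :
  (forall j, (size (rep psi j) <= size (rep psi' j))%N) ->
  (size (rep psi i) < size (rep psi' i))%N -> (norm psi < norm psi')%N.
Proof.
move=> le lt; rewrite /norm (bigD1 i) //= [X in (_ < X)%N](bigD1 i) //=.
by rewrite -addSn leq_add // leq_sum.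
Qed.

Lemma fact_is_rep (phi : Phi Gi) psi i u : is_rep psi i u ->
  is_rep (fact_aut spl phi * psi) i u.
Proof.
move=> [ru eu h1 h2]; split=> // [a|b].
  by rewrite autE_mul fact_aut_incl.
have [a ha] := h2 b; exists (autfV (phi i) a).
by rewrite autE_mul fact_aut_incl autfVK.
Qed.

Lemma one_is_rep i : is_rep 1 i [::].
Proof.
by split=> // a; exists a; rewrite autE_one ev_nil invg1 conjg1.
Qed.

Lemma fact_pure (phi : Phi Gi) psi : pure_sym Gi psi ->
  pure_sym Gi (fact_aut spl phi * psi).
Proof.
move=> /pure_symP hp; apply/pure_symP => i; have [u hu] := hp i.
by exists u; apply: fact_is_rep.
Qed.

Lemma rep_fact (phi : Phi Gi) psi i : pure_sym Gi psi ->
  rep (fact_aut spl phi * psi) i = rep psi i.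
Proof. by move=> hp; apply/repE/fact_is_rep/repP. Qed.

Lemma norm_fact (phi : Phi Gi) psi : pure_sym Gi psi ->
  norm (fact_aut spl phi * psi) = norm psi.
Proof. by move=> hp; apply: eq_bigr => i _; rewrite rep_fact. Qed.

Lemma rep_fact1 (phi : Phi Gi) i : rep (fact_aut spl phi) i = [::].
Proof. by apply: repE; rewrite -[fact_aut _ _]mulg1; apply/fact_is_rep/one_is_rep. Qed.

Lemma norm_fact1 (phi : Phi Gi) : norm (fact_aut spl phi) = 0%N.
Proof. by apply: big1 => i _; rewrite rep_fact1. Qed.

(** * Partial conjugations as moves on automorphisms *)

Section Move.
Variables (i j : 'I_n) (ij : i != j).
Implicit Types (a : K i).

Lemma move_same a psi (b : K j) :
  (pconj spl ij a * psi) (incl b) = psi (incl b) ^ (psi (incl a))^-1.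
Proof. by rewrite autE_mul pconj_incl eqxx !gmulfM homV conjVE. Qed.

Lemma move_other a psi k (b : K k) : k != j ->
  (pconj spl ij a * psi) (incl b) = psi (incl b).
Proof. by move=> kj; rewrite autE_mul pconj_incl (negPf kj). Qed.

Lemma move_is_rep a psi u : is_rep psi j u ->
  is_rep (pconj spl ij a * psi) j (crep j (psi (incl a) * ev u)).
Proof. by move=> hu; apply: is_rep_conj hu _ => b; apply: move_same. Qed.

Lemma move_is_rep_other a psi k u : k != j -> is_rep psi k u ->
  is_rep (pconj spl ij a * psi) k u.
Proof.
move=> kj [ru eu h1 h2]; split=> // b; first by rewrite move_other.
by have [c hc] := h2 b; exists c; rewrite move_other.
Qed.

Lemma move_pure a psi : pure_sym Gi psi -> pure_sym Gi (pconj spl ij a * psi).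
Proof.
move=> /pure_symP hp; apply/pure_symP => k; have [u hu] := hp k.
have [E|kj] := eqVneq k j; last by exists u; apply: move_is_rep_other.
by subst k; exists (crep j (psi (incl a) * ev u)); apply: move_is_rep.
Qed.

Lemma rep_move a psi : pure_sym Gi psi ->
  rep (pconj spl ij a * psi) j = crep j (psi (incl a) * ev (rep psi j)).
Proof. by move=> hp; apply/repE/move_is_rep/repP. Qed.

Lemma rep_move_other a psi k : pure_sym Gi psi -> k != j ->
  rep (pconj spl ij a * psi) k = rep psi k.
Proof. by move=> hp kj; apply/repE/move_is_rep_other/repP. Qed.

Lemma norm_move_lt a psi : pure_sym Gi psi ->
  (norm (pconj spl ij a * psi)%g < norm psi)%N =
  (size (rep (pconj spl ij a * psi)%g j) < size (rep psi j))%N.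
Proof.
move=> hp; rewrite /norm (bigD1 j) //= [X in (_ < X)%N](bigD1 j) //=.
rewrite (eq_bigr (fun k => size (rep psi k))) ?ltn_add2r //.
by move=> k kj; rewrite rep_move_other.
Qed.

End Move.

(** Treats all moves with centre [i] and target [j] at once. Write [u_j] as [u_i r] modulo [G_j] and
    split off the [G_i]-letter [c] of [r = c h]; a move replaces [c] by [b c]. No cancellation
    occurs unless [b c = 1], so only [b = c^-1] can change the length. *)
Lemma orbit_form psi i j : i != j -> pure_sym Gi psi ->
  exists (c : K i) (h : W), forall b : K i,
  (b * c != 1 -> crep j (incl b ^ (ev (rep psi i))^-1 * ev (rep psi j)) =
    rep psi i ++ letter (b * c) :: h) /\
  (b * c = 1 -> (size (crep j (incl b ^ (ev (rep psi i))^-1 * ev (rep psi j))) <=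
    size (rep psi i) + size h)%N).
Proof.
move=> ij hp; have [ru eu _ _] := repP i hp.
set u := rep psi i in ru eu *; set v := rep psi j.
have [rr er [t E]] := crepP j ((ev u)^-1 * ev v); set r := crep _ _ in rr er E.
exists (lhead i r), (ltail i r) => b.
(* For an empty tail this is [i != j]; otherwise the last letter is that of [r]. *)
have eh (d : K i) : ~~ ends j (letter d :: ltail i r).
  move: er; rewrite -{1}(lconsK i rr) /lcons; case: ifP => _.
    by case: (ltail i r).
  by case: (ltail i r).
have -> : incl b ^ (ev u)^-1 * ev v = ev (u ++ letter (b * lhead i r) :: ltail i r) * incl t.
  rewrite conjVE -[LHS]mulgA E -{1}(lconsK i rr) ev_cat ev_cons gmulfM !mulgA.
  rewrite /lcons; case: eqP => [->|_]; first by rewrite hom1 mulg1.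
  by rewrite ev_cons !mulgA.
rewrite crep_mulr; split=> [d1|->].
  rewrite crep_ev1 //; last by rewrite ends_cat; apply: eh.
  by rewrite reduced_cat /= ru eu d1 starts_ltail // reduced_ltail.
by rewrite -size_cat ev_cat ev_cons hom1 mul1g -ev_cat size_crep_ev.
Qed.

Section MoveNorm.
Variables (i j : 'I_n) (ij : i != j) (psi : aut G).
Hypothesis hp : pure_sym Gi psi.
Implicit Types (a : K i).

(** [psi] itself sits at [b = 1] in [orbit_form]. All [b] with [b * c != 1] give the same length, so
    a drop forces [c != 1] and [b = c^-1]: the letter [c] is deleted. *)
Lemma descent_form a : (norm (pconj spl ij a * psi)%g < norm psi)%N ->
  exists (x : K i) (h : W), rep psi j = rep psi i ++ letter x :: h /\
    psi (incl a) = incl x^-1 ^ (ev (rep psi i))^-1.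
Proof.
rewrite norm_move_lt // rep_move //.
have [_ _ /(_ a)[b hb] _] := repP i hp; rewrite hb.
have [c [h hc]] := orbit_form ij hp; have [_ ej _ _] := repP j hp.
have [rj _ _ _] := repP j hp.
have [] := hc 1; rewrite hom1 conj1g !mul1g crep_ev1 //.
have [c1|c1] := eqVneq c 1 => [_ /(_ c1) le|/(_ isT) E _].
  have [] := hc b; rewrite c1 mulg1; have [->|b1] := eqVneq b 1.
    by rewrite hom1 conj1g mul1g crep_ev1 // ltnn.
  move=> /(_ isT)-> _; rewrite size_cat /= addnS => /leq_trans/(_ le).
  by rewrite ltnNge leqnSn.
have [] := hc b; have [bc1|bc1] := eqVneq (b * c) 1 => [_ _ _|/(_ isT)-> _]; last first.
  by rewrite E !size_cat ltnn.
by exists c, h; split=> //; rewrite -(mulg1_eq bc1) invgK.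
Qed.

Lemma form_descent a (x : K i) h : rep psi j = rep psi i ++ letter x :: h ->
  psi (incl a) = incl x^-1 ^ (ev (rep psi i))^-1 ->
  (norm (pconj spl ij a * psi)%g < norm psi)%N.
Proof.
move=> E Ea; rewrite norm_move_lt // rep_move // Ea E conjVE.
rewrite ev_cat ev_cons homV !mulgA mulgVK mulgVK -ev_cat.
by rewrite (leq_ltn_trans (size_crep_ev _ _)) // !size_cat /= addnS.
Qed.

(** In the third case the letter is merely exchanged for another one, and deleting it goes below
    both ends of the move. *)
Lemma move_cases a : a != 1 ->
  [\/ (norm psi < norm (pconj spl ij a * psi)%g)%N,
      (norm (pconj spl ij a * psi)%g < norm psi)%N
    | exists2 a0, (norm (pconj spl ij a0 * psi)%g < norm psi)%N &
        (norm (pconj spl ij a0 * psi)%g < norm (pconj spl ij a * psi)%g)%N].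
Proof.
move=> a1; have [rj ej _ _] := repP j hp; have [_ _ h1 h2] := repP i hp.
have [b hb] := h1 a; have [c [h hc]] := orbit_form ij hp.
have b1 : b != 1.
  apply: contraNneq a1 => b1; rewrite -incl_eq1; apply/eqP/(can_inj (autfK psi)).
  by rewrite hb b1 hom1 conj1g [RHS]hom1.
have up a' k : k != j -> rep (pconj spl ij a' * psi) k = rep psi k.
  exact: rep_move_other.
have [] := hc 1; rewrite hom1 conj1g !mul1g crep_ev1 //.
have [c1|c1] := eqVneq c 1 => [_ /(_ c1) le|/(_ isT) E _].
  have [] := hc b; rewrite c1 mulg1 => /(_ b1) E _.
  have lt : (size (rep psi j) < size (rep (pconj spl ij a * psi)%g j))%N.
    by rewrite rep_move // hb E size_cat /= addnS ltnS.
  apply: Or31; apply: (norm_lt (i := j)) => // k.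
  by have [->|kj] := eqVneq k j; [exact: ltnW|rewrite up].
have [a0 h0] := h2 c^-1.
have lt0 := form_descent E h0.
have [bc1|bc1] := eqVneq (b * c) 1.
  by apply: Or32; apply: form_descent E _; rewrite hb -(mulg1_eq bc1) invgK.
apply: Or33; exists a0 => //.
have lt : (size (rep (pconj spl ij a0 * psi)%g j) < size (rep (pconj spl ij a * psi)%g j))%N.
  move: lt0; rewrite norm_move_lt // => lt0; apply: leq_trans lt0 _.
  rewrite (rep_move _ a) // hb; have [-> // _] := hc b.
  by rewrite E !size_cat.
apply: (norm_lt (i := j)) => // k.
by have [->|kj] := eqVneq k j; [exact: ltnW|rewrite !up].
Qed.

End MoveNorm.

(* Ping-pong: when no move decreases the norm, the letters of the image of a
   word never cancel, so a letter of [G_j] can be an image only if [rep psi j]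
   is empty. *)
Lemma no_descent_image psi w : pure_sym Gi psi ->
  (forall i j (x : K i) h, i != j -> rep psi j <> rep psi i ++ letter x :: h) ->
  reduced w ->
  if w is l :: _ then exists (b : K (tag l)) z,
    wd (psi (ev w)) = rep psi (tag l) ++ letter b :: z
  else wd (psi (ev w)) = [::].
Proof.
move=> hp nod; elim: w => [_|[i a] w IHw]; first by rewrite ev_nil hom1 -ev_nil wd_ev.
move=> /= /and3P[a1 sw rw]; have [ru eu h1 _] := repP i hp.
have [b hb] := h1 a; exists b.
have b1 : b != 1.
  apply: contraNneq a1 => b1; rewrite -incl_eq1; apply/eqP/(can_inj (autfK psi)).
  by rewrite hb b1 hom1 conj1g [RHS]hom1.
set u := rep psi i in ru eu hb *.
have ry := wd_reduced ((ev u)^-1 * psi (ev w)).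
have := wdK ((ev u)^-1 * psi (ev w)); move: (wd ((ev u)^-1 * _)) ry => y ry Ey.
(* Otherwise the normal form of [psi (ev w)] would begin both with [u] and a letter of [G_i] and
   with [rep psi k] and a letter of [G_k], [k != i]; one of these two words would extend the other
   in the way that [nod] excludes. *)
have sy : ~~ starts i y.
  apply/negP => /starts_letter E; move: (ry); rewrite E /= => /and3P[c1 sz rz].
  set c := lhead i y in E c1; set z := ltail i y in E sz rz.
  have Ew : wd (psi (ev w)) = u ++ letter c :: z.
    by rewrite -[psi _](mulVKg (ev u)) -Ey E -ev_cat wd_ev // reduced_cat /= ru eu c1 sz.
  have := IHw rw; case: w sw rw {IHw Ey} Ew => [_ _ ->|[k d] w /= ki _ ->].
    by case: (u).
  case=> e [z' Ez']; have ik : i != k by rewrite eq_sym.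
  case: (eq_cat_cons _ Ez') => // -[r [Er _]]; last by rewrite eq_sym in ik; apply: nod ik Er.
  exact: nod ik Er.
exists y; rewrite ev_cons autf_morph hb -[psi (ev w)](mulVKg (ev u)) -Ey conjVE.
rewrite mulgA mulgVK -mulgA -ev_cons -ev_cat wd_ev //.
by rewrite reduced_cat /= ru eu b1 sy ry.
Qed.

Lemma descent_exists psi : pure_sym Gi psi -> (exists j, rep psi j <> [::]) ->
  exists i j (ij : i != j) (a : K i), (norm (pconj spl ij a * psi)%g < norm psi)%N.
Proof.
move=> hp [j uj]; apply: contrapT => nex; apply: uj.
have nod i k (x : K i) h : i != k -> rep psi k <> rep psi i ++ letter x :: h.
  move=> ik E; apply: nex; have [_ _ _ h2] := repP i hp.
  by have [a ha] := h2 x^-1; exists i, k, ik, a; apply: form_descent E ha.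
(* Ping-pong is applied to the preimage of a single letter [x] of [G_j]: the image
   [rep psi k ++ letter b :: z] has length one, so [rep psi k] is empty and [k = j]. *)
have [x x1] := neq1_factor j; have rw := wd_reduced (autfV psi (incl x)).
have := no_descent_image hp nod rw; rewrite wdK autfVK.
have -> : wd (incl x) = [:: letter x].
  by rewrite -[incl x]mulg1 -ev_nil -ev_cons wd_ev //= x1.
case: (wd _) => // -[k c] w [b [z]] /=.
by case E : (rep psi k) => [|l [|m v]] // [kj _]; rewrite kj.
Qed.

(** * The relations between moves and factor automorphisms, in [aut G] *)

Lemma aut_ext (f g : aut G) :
  (forall i (a : K i), f (incl a) = g (incl a)) -> f = g.
Proof. by move=> fg; apply: autP; apply: (split_hom_ext spl) fg. Qed.

Lemma autf_V (f : aut G) x : f x^-1 = (f x)^-1.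
Proof. exact: homV. Qed.

Lemma fact_aut_inj : injective (fact_aut spl).
Proof.
move=> phi chi E; apply/ffunP => i; apply: autP => a; apply: val_inj.
by have := fact_aut_incl spl phi a; rewrite E fact_aut_incl => /esym.
Qed.

Lemma pconj1 i j (ij : i != j) : pconj spl ij 1 = 1.
Proof. by apply: (mulgI (pconj spl ij 1)); rewrite -pconjM !mulg1. Qed.

Lemma pconjK i j (ij : i != j) (a : K i) psi :
  pconj spl ij a^-1 * (pconj spl ij a * psi) = psi.
Proof. by rewrite mulgA -pconjM mulVg pconj1 mul1g. Qed.

Lemma pconj_in i j (ij : i != j) (a : K i) (x : K j) :
  pconj spl ij a (incl x) = incl a * incl x * (incl a)^-1.
Proof. by rewrite pconj_incl eqxx. Qed.

Lemma pconj_out i j k (ij : i != j) (a : K i) (x : K k) : k != j ->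
  pconj spl ij a (incl x) = incl x.
Proof. by rewrite pconj_incl => /negPf->. Qed.

(** The case [i = k] is allowed, so relations 1 and 2 are treated together: neither move affects the
    target or the conjugating element of the other. *)
Lemma pconj_comm i j k l (ij : i != j) (kl : k != l) (a : K i) (c : K k) :
  j != l -> k != j -> i != l -> commute (pconj spl ij a) (pconj spl kl c).
Proof.
move=> jl kj il; apply: aut_ext => m x; rewrite !autE_mul.
have aE := pconj_out kl c a il; have cE := pconj_out ij a c kj.
have [mj|mj] := eqVneq m j.
  subst m; rewrite (pconj_out kl c x jl) !(autf_morph, autf_V, pconj_in, aE).
  by rewrite (pconj_out kl c x jl).
rewrite (pconj_out ij a x mj); have [ml|ml] := eqVneq m l.
  by subst m; rewrite !(autf_morph, autf_V, pconj_in, cE, pconj_out ij a x mj).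
by rewrite (pconj_out kl c x ml) (pconj_out ij a x mj).
Qed.

(** On [G_j] and [G_k] the product of the two moves centred at [i] is a single conjugation by
    [a^-1], while the move by [c] maps the group generated by [G_j] and [G_k] to itself and fixes
    [a]. *)
Lemma pconj_hex i j k (ij : i != j) (ik : i != k) (kj : k != j) (a : K i) (c : K k) :
  commute (pconj spl kj c) (pconj spl ij a * pconj spl ik a).
Proof.
have jk : j != k by rewrite eq_sym.
have aE := (pconj_out ij a a ij, pconj_out ik a a ik, pconj_out kj c a ij).
apply: aut_ext => m x; rewrite !autE_mul.
have [mj|mj] := eqVneq m j.
  subst m; rewrite !(autf_morph, autf_V, aE, pconj_in, pconj_out ik a x jk, pconj_out ij a c kj).
  by rewrite !invgM invgK !mulgA !mulgVK.
rewrite (pconj_out kj c x mj) (pconj_out ij a x mj); have [mk|mk] := eqVneq m k.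
  by subst m; rewrite !(autf_morph, autf_V, aE, pconj_in, pconj_out kj c x kj).
by rewrite (pconj_out ik a x mk) (pconj_out kj c x mj).
Qed.

Lemma pconj_fact i j (ij : i != j) (a : K i) (phi : Phi Gi) :
  pconj spl ij a * fact_aut spl phi = fact_aut spl phi * pconj spl ij (phi i a).
Proof.
apply: aut_ext => m x; rewrite !autE_mul fact_aut_incl !pconj_incl.
by case: eqP => _; rewrite ?autf_morph ?autf_V !fact_aut_incl.
Qed.

(** * The presented group and lifts to it *)

Local Notation rels := (fun r : fprod (gen_group spl) =>
  exists p q, pure_rel p q /\ r = p / q).
Local Notation Gam := (quotg (normal_closure rels)).
Local Notation cls := (qproj (normal_closure rels)).

Definition Fr i j (ij : i != j) (a : K i) : Gam := cls (genf spl ij a).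

Definition Fphi (phi : Phi Gi) : Gam := cls (genphi spl phi).

Lemma pure_relE p q : pure_rel p q -> cls p = cls q.
Proof. by move=> h; apply/qprojP/asboolP/ncl_gen; exists p, q. Qed.

Lemma FrM i j (ij : i != j) : {morph Fr ij : a b / a * b}.
Proof. by move=> a b; rewrite /Fr /genf !gmulfM. Qed.

Lemma Fr1 i j (ij : i != j) : Fr ij 1 = 1.
Proof. by apply: (mulgI (Fr ij 1)); rewrite -FrM !mulg1. Qed.

Lemma FrV i j (ij : i != j) a : Fr ij a^-1 = (Fr ij a)^-1.
Proof. by apply: (mulgI (Fr ij a)); rewrite -FrM !mulgV Fr1. Qed.

Lemma FphiM : {morph Fphi : phi chi / phi * chi}.
Proof. by move=> phi chi; rewrite /Fphi /genphi !gmulfM. Qed.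

Lemma Fphi1 : Fphi 1 = 1.
Proof. by apply: (mulgI (Fphi 1)); rewrite -FphiM !mulg1. Qed.

Lemma cls_comm p q : pure_rel [~ p, q] 1 -> commute (cls p) (cls q).
Proof.
move=> /pure_relE E; apply/commgP/eqP; move: E.
by rewrite !commgEl !conjgE !gmulfM !homV hom1.
Qed.

Lemma Fr_comm i j k l (ij : i != j) (kl : k != l) (a : K i) (c : K k) :
  j != l -> k != j -> i != l -> commute (Fr ij a) (Fr kl c).
Proof.
move=> jl kj il; have [ik|ik] := eqVneq i k.
  by subst k; apply: cls_comm; apply: pure_rel1.
apply: cls_comm; apply: pure_rel2.
by rewrite /= !inE !negb_or ij ik il [j == k]eq_sym kj jl kl.
Qed.

Lemma Fr_hex i j k (ij : i != j) (ik : i != k) (kj : k != j) (a : K i) (c : K k) :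
  commute (Fr kj c) (Fr ij a * Fr ik a).
Proof.
have -> : Fr ij a * Fr ik a = Fr ik a * Fr ij a.
  by apply: Fr_comm => //; rewrite eq_sym.
by rewrite /Fr -[X in commute _ X]gmulfM; apply: cls_comm; apply: pure_rel3.
Qed.

Lemma Fr_phi i j (ij : i != j) (a : K i) phi :
  Fr ij a * Fphi phi = Fphi phi * Fr ij (phi i a).
Proof.
by rewrite /Fr -(pure_relE (pure_rel5 spl ij a phi)) !gmulfM homV !mulgA mulgV mul1g.
Qed.

(* [lifts psi c]: the element [c] of the presented group is read off a chain of
   moves along which the norm grows strictly from 0 to [norm psi]. *)
Inductive lifts : aut G -> Gam -> Prop :=
| lifts_fact phi : lifts (fact_aut spl phi) (Fphi phi)
| lifts_move i j (ij : i != j) (a : K i) psi c :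
    (norm psi < norm (pconj spl ij a * psi)%g)%N -> lifts psi c ->
    lifts (pconj spl ij a * psi) (Fr ij a * c).

Lemma pure_one : pure_sym Gi (1 : aut G).
Proof. by apply/pure_symP => i; exists [::]; apply: one_is_rep. Qed.

Lemma lifts_pure psi c : lifts psi c -> pure_sym Gi psi.
Proof.
elim=> [phi|i j ij a {}psi {}c _ _]; last exact: move_pure.
by rewrite -[fact_aut _ _]mulg1; apply/fact_pure/pure_one.
Qed.

Lemma lifts_inv psi c : lifts psi c ->
  (exists2 phi, psi = fact_aut spl phi & c = Fphi phi) \/
  (exists i j (ij : i != j) (a : K i) c',
    [/\ (norm (pconj spl ij a * psi)%g < norm psi)%N,
        lifts (pconj spl ij a * psi) c' & c = Fr ij a^-1 * c']).
Proof.
case=> [phi|i j ij a {}psi {}c lt hc]; first by left; exists phi.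
right; exists i, j, ij, a^-1, c; have E := pconjK ij a psi.
by rewrite E invgK.
Qed.

Lemma rep_nil_fact psi : pure_sym Gi psi -> (forall i, rep psi i = [::]) ->
  exists phi, psi = fact_aut spl phi.
Proof.
move=> hp r0.
have hi i : exists f : aut (K i), forall a, incl (f a) = psi (incl a).
  have [_ _] := repP i hp; rewrite r0 ev_nil invg1 => h1 h2.
  have m1 (a : K i) : psi (incl a) \in Gi i.
    by have [b ->] := h1 a; rewrite conjg1; apply: inclP.
  have m2 (b : K i) : autfV psi (incl b) \in Gi i.
    by have [a E] := h2 b; rewrite conjg1 in E; rewrite -E autfK; apply: inclP.
  have fM : {morph (fun a : K i => Subgrp (m1 a)) : a b / a * b}.
    by move=> a b; apply: val_inj; rewrite /= autf_morph.
  have fK : cancel (fun a : K i => Subgrp (m1 a)) (fun a => Subgrp (m2 a)).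
    by move=> a; apply: val_inj; rewrite /= autfK.
  have fVK : cancel (fun a : K i => Subgrp (m2 a)) (fun a => Subgrp (m1 a)).
    by move=> a; apply: val_inj; rewrite /= autfVK.
  by exists (Aut fM fK fVK).
exists ([ffun i => sval (cid (hi i))] : Phi Gi); apply: aut_ext => i a.
by rewrite fact_aut_incl ffunE; case: cid.
Qed.

Lemma lifts_exists psi : pure_sym Gi psi -> exists c, lifts psi c.
Proof.
have [m] := ubnP (norm psi); elim: m psi => // m IHm psi /ltnSE-le hp.
have [r0|/existsNP rn] := pselect (forall i, rep psi i = [::]).
  by have [phi ->] := rep_nil_fact hp r0; exists (Fphi phi); apply: lifts_fact.
have [i [j [ij [a lt]]]] := descent_exists hp rn.
have [c hc] := IHm _ (leq_trans lt le) (move_pure ij a hp).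
exists (Fr ij a^-1 * c); rewrite -(pconjK ij a psi); apply: lifts_move => //.
by rewrite pconjK.
Qed.

Definition lift_unique psi := forall c d, lifts psi c -> lifts psi d -> c = d.

(** Removes the growth condition of [lifts_move]. A descending move is compared with the ascent that
    undoes it, by uniqueness at [psi]; a sideways move goes through the lower automorphism supplied
    by [move_cases]. *)
Lemma lifts_pconj i j (ij : i != j) (a : K i) psi c : lift_unique psi ->
  lifts psi c -> lifts (pconj spl ij a * psi) (Fr ij a * c).
Proof.
move=> uq hc; have hp := lifts_pure hc.
have [->|a1] := eqVneq a 1; first by rewrite pconj1 Fr1 !mul1g.
have down b : (norm (pconj spl ij b * psi)%g < norm psi)%N ->
    lifts (pconj spl ij b * psi) (Fr ij b * c).
  move=> lt; have [d hd] := lifts_exists (move_pure ij b hp).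
  have : lifts (pconj spl ij b^-1 * (pconj spl ij b * psi)) (Fr ij b^-1 * d).
    by apply: lifts_move => //; rewrite pconjK.
  by rewrite pconjK => /(uq _ _ hc)->; rewrite FrV mulVKg.
case: (move_cases ij hp a1) => [lt|lt|[b lt lt']].
- exact: lifts_move.
- exact: down.
have := @lifts_move _ _ ij (a * b^-1) (pconj spl ij b * psi) (Fr ij b * c).
by rewrite !mulgA -pconjM -FrM !mulgVK => h; apply: h => //; apply: down.
Qed.

(** * Local confluence of descents *)

Section LocalConfluence.
Variable psi : aut G.
Hypothesis hp : pure_sym Gi psi.
Hypothesis IH : forall chi, (norm chi < norm psi)%N -> lift_unique chi.

(** The moves change different words, [rep psi j] and [rep psi l]; commutation shows that the second
    shortens [rep psi l] exactly as it does at [psi]. *)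
Lemma square_norm i j k l (ij : i != j) (kl : k != l) (a : K i) (c : K k) :
  j != l -> k != j -> i != l ->
  (norm (pconj spl ij a * psi)%g < norm psi)%N ->
  (norm (pconj spl kl c * psi)%g < norm psi)%N ->
  (norm (pconj spl kl c * (pconj spl ij a * psi))%g < norm psi)%N.
Proof.
move=> jl kj il lt1 lt2; apply: ltn_trans lt1.
have hp1 := move_pure ij a hp; have hp2 := move_pure kl c hp.
rewrite norm_move_lt // mulgA -pconj_comm // -mulgA.
have lj : l != j by rewrite eq_sym.
by rewrite (rep_move_other ij a hp2 lj) (rep_move_other ij a hp lj) -norm_move_lt.
Qed.

Lemma square_confluence i j k l (ij : i != j) (kl : k != l) (a : K i) (c : K k) (x y : Gam) :
  j != l -> k != j -> i != l ->
  (norm (pconj spl ij a * psi)%g < norm psi)%N ->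
  (norm (pconj spl kl c * psi)%g < norm psi)%N ->
  lifts (pconj spl ij a * psi) x -> lifts (pconj spl kl c * psi) y ->
  Fr ij a^-1 * x = Fr kl c^-1 * y.
Proof.
move=> jl kj il lt1 lt2 hx hy.
have hx' := lifts_pconj kl c (IH lt1) hx; have hy' := lifts_pconj ij a (IH lt2) hy.
move: hy'; rewrite mulgA (pconj_comm ij kl a c) // -mulgA => hy'.
have E := IH (square_norm jl kj il lt1 lt2) hx' hy'.
rewrite !FrV; apply: (mulgI (Fr ij a)); apply: (mulgI (Fr kl c)).
by rewrite mulVKg E !mulgA -(Fr_comm ij kl a c jl kj il) mulgK.
Qed.

(** One path continues from [f_(i_k)(a)] with [f_(i_j)(a)] and [f_(k_j)(c)], the other from
    [f_(k_j)(c)] with [f_(i_k)(a)] and [f_(i_j)(a)]; [pconj_hex] identifies their ends. *)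
Lemma hexagon_confluence i k j (ik : i != k) (kj : k != j) (a : K i) (c : K k) (x y : Gam) :
  (norm (pconj spl ik a * psi)%g < norm psi)%N ->
  (norm (pconj spl kj c * psi)%g < norm psi)%N ->
  lifts (pconj spl ik a * psi) x -> lifts (pconj spl kj c * psi) y ->
  Fr ik a^-1 * x = Fr kj c^-1 * y.
Proof.
move=> lt1 lt2 hx hy.
have [s [r [Ek Ea]]] := descent_form hp lt1; have [t [h [Ej Ec]]] := descent_form hp lt2.
have ij : i != j.
  apply/eqP => E; subst j; move: Ek => /(congr1 size).
  rewrite Ej !size_cat /= -addnA -[X in X = _]addn0 => /eqP.
  by rewrite eqn_add2l addnS.
have jk : j != k by rewrite eq_sym.
(* [rep psi j] extends [rep psi i] by the same letter [s] as [rep psi k] does, so [a] lowers the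
   norm with target [j] too. *)
have lt0 : (norm (pconj spl ij a * psi)%g < norm psi)%N.
  by apply: (form_descent ij hp (h := r ++ letter t :: h) _ Ea); rewrite Ej Ek -catA.
have lt4 := square_norm (a := a) (c := a) (kl := ij) (ij := ik) kj ik ij lt1 lt0.
have hp3 := move_pure kj c hp.
set psi3 := pconj spl kj c * psi in lt2 hy hp3.
have hp5 := move_pure ik a hp3.
have a3 : psi3 (incl a) = psi (incl a) by rewrite /psi3 move_other.
have k3 : rep psi3 k = rep psi k by rewrite /psi3 rep_move_other.
have k5 : rep (pconj spl ik a * psi3) k = rep (pconj spl ik a * psi) k.
  by rewrite !rep_move // a3 k3.
have lt5 : (norm (pconj spl ik a * psi3)%g < norm psi)%N.
  apply: ltn_trans lt2; rewrite norm_move_lt // k5 k3.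
  by rewrite -norm_move_lt.
(* At the far vertex both [s] and [t] have been deleted from [u_j = u_i s r t h], which leaves at
   most the letters of [u_i r h]. *)
have j6 : (size (rep (pconj spl ij a * (pconj spl ik a * psi3))%g j) < size (rep psi j))%N.
  rewrite rep_move // move_other // a3 rep_move_other // /psi3 rep_move //.
  have [_ _ [t' E]] := crepP j (psi (incl c) * ev (rep psi j)).
  have -> : psi (incl a) * ev (crep j (psi (incl c) * ev (rep psi j))) =
      psi (incl a) * (psi (incl c) * ev (rep psi j)) * incl t'^-1.
    by rewrite {2}E homV !mulgA mulgK.
  rewrite crep_mulr Ea Ec Ej ev_cat ev_cons !conjVE !homV !mulgA !mulgVK.
  rewrite Ek ev_cat ev_cons !mulgA !mulgVK -!ev_cat.
  by rewrite (leq_ltn_trans (size_crep_ev _ _)) // !size_cat /= !addnS ltnS leqW.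
have lt6 : (norm (pconj spl ij a * (pconj spl ik a * psi3))%g < norm psi)%N.
  apply: norm_lt (j6) => m; have [->|mj] := eqVneq m j; first exact: ltnW.
  rewrite rep_move_other //; have [->|mk] := eqVneq m k.
    by rewrite k5; apply: ltnW; rewrite -norm_move_lt.
  by rewrite !rep_move_other.
have hx6 := lifts_pconj kj c (IH lt4) (lifts_pconj ij a (IH lt1) hx).
have hy6 := lifts_pconj ij a (IH lt5) (lifts_pconj ik a (IH lt2) hy).
have E6 : pconj spl kj c * (pconj spl ij a * (pconj spl ik a * psi)) =
    pconj spl ij a * (pconj spl ik a * psi3).
  by rewrite /psi3 !mulgA -(mulgA (pconj spl kj c)) (pconj_hex ij ik kj a c).
rewrite E6 in hx6; have E := IH lt6 hx6 hy6.
rewrite !FrV; apply: (mulgI (Fr ik a)); apply: (mulgI (Fr ij a)); apply: (mulgI (Fr kj c)).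
rewrite mulVKg E [X in _ = _ * X]mulgA [X in _ = X]mulgA (Fr_hex ij ik kj a c).
by rewrite -mulgA mulVKg !mulgA.
Qed.

(** The auxiliary descent [f_(i_k)(a)] forms a hexagon with [f_(k_j)(c)] and a square with
    [f_(i_j)(a)]. *)
Lemma common_target_confluence i k j (ij : i != j) (kj : k != j) (a : K i) (c : K k)
    (s : K i) r (x y : Gam) :
  i != k -> rep psi k = rep psi i ++ letter s :: r ->
  psi (incl a) = incl s^-1 ^ (ev (rep psi i))^-1 ->
  (norm (pconj spl ij a * psi)%g < norm psi)%N ->
  (norm (pconj spl kj c * psi)%g < norm psi)%N ->
  lifts (pconj spl ij a * psi) x -> lifts (pconj spl kj c * psi) y ->
  Fr ij a^-1 * x = Fr kj c^-1 * y.
Proof.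
move=> ik Ek Ea lt1 lt2 hx hy; have lt0 := form_descent ik hp Ek Ea.
have [z hz] := lifts_exists (move_pure ik a hp).
rewrite -(hexagon_confluence lt0 lt2 hz hy).
by apply: square_confluence lt1 lt0 hx hz => //; rewrite eq_sym.
Qed.

End LocalConfluence.

(** Induction on the norm in the manner of Newman's lemma: the first descents of two lifts are
    compared by their centres and targets. A factor automorphism has norm 0 and so admits no
    descent. *)
Lemma lifts_unique psi : lift_unique psi.
Proof.
have [m] := ubnP (norm psi); elim: m psi => // m IHm psi /ltnSE-le x y hx hy.
have IH chi : (norm chi < norm psi)%N -> lift_unique chi.
  by move=> lt; apply: IHm; apply: leq_trans lt le.
have hp := lifts_pure hx.
case: (lifts_inv hx) => [[phi E ->]|[i [j [ij [a [x' [lt1 {}hx ->]]]]]]].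
  case: (lifts_inv hy) => [[chi E' ->]|[i [j [ij [a [y' [lt _ _]]]]]]].
    by congr Fphi; apply: fact_aut_inj; rewrite -E.
  by move: lt; rewrite {2}E norm_fact1.
case: (lifts_inv hy) => [[chi E' _]|[k [l [kl [c [y' [lt2 {}hy ->]]]]]]].
  by move: lt1; rewrite {2}E' norm_fact1.
have [jl|jl] := eqVneq j l.
  subst l; have [ik|ik] := eqVneq i k.
    subst k; have <- := bool_irrelevance ij kl.
    rewrite -(bool_irrelevance ij kl) in hy lt2.
    (* With equal centres and targets the two results differ by the move [c * a^-1], and both lie
       below [psi]. *)
    have := lifts_pconj ij (c * a^-1) (IH _ lt1) hx.
    rewrite mulgA -pconjM mulgVK => /(IH _ lt2 _ _ hy)->.
    by rewrite mulgA -FrM mulKg.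
  have [s [h [E Ea]]] := descent_form hp lt1; have [t [h' [E' Ec]]] := descent_form hp lt2.
  (* Both descents delete a letter of the same word; as [i != k], one of [rep psi i] and [rep psi k]
     extends the other by its deleted letter. *)
  have := E'; rewrite E => /eq_cat_cons-/(_ ik)[[r [Er _]]|[r [Er _]]].
    exact: common_target_confluence Er Ea lt1 lt2 hx hy.
  by apply/esym/(common_target_confluence hp IH _ Er Ec lt2 lt1 hy hx); rewrite eq_sym.
have [kj|kj] := eqVneq k j; first by subst k; apply: hexagon_confluence lt1 lt2 hx hy.
have [il|il] := eqVneq i l; first by subst l; apply/esym/(hexagon_confluence hp IH lt2 lt1 hy hx).
exact: square_confluence lt1 lt2 hx hy.
Qed.

(** * Compatibility of lifts with factor and inner automorphisms *)

Lemma lifts_phi psi c phi : lifts psi c -> lifts (fact_aut spl phi * psi) (Fphi phi * c).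
Proof.
elim=> [chi|i j ij a {}psi {}c lt hc IH].
  by rewrite -fact_autM -FphiM; apply: lifts_fact.
(* Writing [a] as an image under [phi i] puts relation 5 in the form that carries [phi] inwards,
   past the move. *)
have E : (phi i) (autfV (phi i) a) = a by rewrite autfVK.
have hp := lifts_pure hc.
rewrite !mulgA -{1}E -pconj_fact -{2}E -Fr_phi -!mulgA.
apply: lifts_move => //; rewrite mulgA pconj_fact E -mulgA.
by rewrite !norm_fact //; apply: move_pure.
Qed.

Lemma autf_J (f : aut G) x y : f (x ^ y) = f x ^ f y.
Proof. exact: homJ. Qed.

Lemma prod_pconj_in i (I : eqType) (v : I -> 'I_n) (iv : forall m, i != v m) (a : K i)
    k (x : K k) (s : seq I) : uniq [seq v m | m <- s] ->
  (\prod_(m <- s) pconj spl (iv m) a) (incl x) =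
  if k \in [seq v m | m <- s] then incl x ^ (incl a)^-1 else incl x.
Proof.
have aE (r : seq I) : (\prod_(m <- r) pconj spl (iv m) a) (incl a) = incl a.
  elim: r => [|m r IHr]; first by rewrite big_nil.
  by rewrite big_cons autE_mul pconj_out.
elim: s => [|m s IHs]; first by rewrite big_nil.
rewrite big_cons autE_mul map_cons cons_uniq inE => /andP[ms us].
have [km|km] := eqVneq k (v m).
  subst k; rewrite pconj_in !(autf_morph, autf_V) aE IHs // (negPf ms).
  by rewrite conjVE.
by rewrite pconj_out // IHs.
Qed.

Lemma mem_avoiding i (v : 'I_n.-1 -> 'I_n) : (forall m, i != v m) -> injective v ->
  forall k, (k \in [seq v m | m <- index_enum 'I_n.-1]) = (k != i).
Proof.
move=> iv vinj k.
have -> : (k \in [seq v m | m <- index_enum 'I_n.-1]) = (k \in v @: 'I_n.-1).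
  apply/mapP/imsetP => -[m _ ->]; exists m => //; exact: mem_index_enum.
suff -> : v @: 'I_n.-1 = [set~ i]%SET by rewrite !inE.
apply/eqP; rewrite eqEcard card_imset // cardsC1 !card_ord leqnn andbT.
by apply/fintype.subsetP => _ /imsetP[m _ ->]; rewrite !inE eq_sym iv.
Qed.

Lemma AdE i (a : K i) k (x : K k) : incl (Ad a k x) = if k == i then incl x ^ incl a else incl x.
Proof.
rewrite /Ad ffunE; have [ki|ki] := eqVneq k i; last by rewrite dfwith_out // eq_sym.
by subst k; rewrite dfwith_in; apply: (homJ (@incl G (Gi i))).
Qed.

(* Relation 4, read in [aut G]. *)
Lemma prod_pconj_inn i (v : 'I_n.-1 -> 'I_n) (iv : forall m, i != v m) (a : K i) :
  injective v ->
  (\prod_(m < n.-1) pconj spl (iv m) a^-1) * fact_aut spl (Ad a) = inn (incl a).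
Proof.
move=> vinj; apply: aut_ext => k x; rewrite autE_mul prod_pconj_in; last first.
  by rewrite map_inj_uniq // index_enum_uniq.
have aE : fact_aut spl (Ad a) (incl a) = incl a.
  by rewrite fact_aut_incl AdE eqxx conjgE mulKg.
rewrite (mem_avoiding iv vinj) homV invgK; case: ifPn => [ki|/negPn ki].
  by rewrite autf_J aE fact_aut_incl AdE (negPf ki).
by rewrite fact_aut_incl AdE ki.
Qed.

Lemma AdM i : {morph @Ad G n Gi i : a b / a * b}.
Proof.
move=> a b; apply/ffunP => k; apply: autP => x; apply: val_inj.
have -> : (Ad a * Ad b) k = Ad a k * Ad b k by exact: ffunE.
rewrite autE_mul -![val _]/(incl _) !AdE; case: eqP => // ki.
by rewrite gmulfM conjgM.
Qed.

Lemma Ad1 i : Ad (1 : K i) = 1 :> Phi Gi.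
Proof. by apply: (@mulgI (Phi Gi) (Ad (1 : K i))); rewrite -[LHS]AdM !mulg1. Qed.

Lemma prod_Fr i (v : 'I_n.-1 -> 'I_n) (iv : forall m, i != v m) (a : K i) :
  injective v -> \prod_(m < n.-1) Fr (iv m) a = Fphi (Ad a).
Proof.
move=> vinj; rewrite /Fphi -(pure_relE (pure_rel4 spl iv a vinj)).
by apply/esym/(big_morph cls) => [p q|]; rewrite ?gmulfM ?hom1.
Qed.

Lemma lifts_prod i (I : Type) (s : seq I) (v : I -> 'I_n) (iv : forall m, i != v m)
    (a : K i) psi c : lifts psi c ->
  lifts ((\prod_(m <- s) pconj spl (iv m) a) * psi) ((\prod_(m <- s) Fr (iv m) a) * c).
Proof.
move=> hc; elim: s => [|m s IHs]; first by rewrite !big_nil !mul1g.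
by rewrite !big_cons -!mulgA; apply: lifts_pconj => //; apply: lifts_unique.
Qed.

(** With [lift i] enumerating the indices other than [i], the inner automorphism is a product of
    moves by [a^-1] followed by [Ad a]; relation 4 turns its lift into that of
    [Ad a^-1 * Ad a = 1]. *)
Lemma lifts_inn_incl i (a : K i) psi c : lifts psi c -> lifts (inn (incl a) * psi) c.
Proof.
move=> hc; have iv m : i != lift i m by apply: neq_lift.
rewrite -(prod_pconj_inn iv a (@lift_inj _ _)) -mulgA.
have := lifts_prod (index_enum 'I_n.-1) iv a^-1 (lifts_phi (Ad a) hc).
have E : Fphi (Ad a^-1) * Fphi (Ad a) = 1 by rewrite -FphiM -[X in Fphi X]AdM mulVg Ad1 Fphi1.
by rewrite (prod_Fr iv _ (@lift_inj _ _)) [X in lifts _ X]mulgA E mul1g.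
Qed.

Lemma fact_aut1 : fact_aut spl 1 = 1.
Proof. by apply: (mulgI (fact_aut spl 1)); rewrite -fact_autM !mulg1. Qed.

Lemma lifts1 : lifts 1 1.
Proof. by rewrite -fact_aut1 -Fphi1; apply: lifts_fact. Qed.

Lemma lifts_inn x : lifts (inn x) 1.
Proof.
rewrite -(wdK x); elim: (wd x) => [|[i a] u IHu].
  rewrite ev_nil; have -> : inn 1 = 1 :> aut G by apply: autP => y; rewrite /= conjg1.
  exact: lifts1.
rewrite ev_cons; have -> : inn (incl a * ev u) = inn (incl a) * inn (ev u).
  by apply: autP => y; rewrite autE_mul /= conjgM.
exact: lifts_inn_incl.
Qed.

(** Generators are prepended one by one; [lifts_pconj] absorbs those moves that do not raise the
    norm. *)
Lemma lifts_total c : exists psi, lifts psi c.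
Proof.
elim/qprojW: c; elim/wclassW; elim=> [|[k b] w [psi hc]].
  by exists 1; have := lifts1; rewrite -(hom1 cls).
have -> : wclass (existT (gen_group spl) k b :: w) = @fpin _ (gen_group spl) k b * wclass w.
  by rewrite -[RHS]/(fprod_mul _ _) wclassM.
rewrite gmulfM; case: k b => [[[i j] ij]|] b; last first.
  by exists (fact_aut spl b * psi); apply: lifts_phi.
have /asboolP[a Ea] := inclP b.
have -> : b = corestr (pconj_class spl ij) a by apply: val_inj.
by exists (pconj spl ij a * psi); apply: lifts_pconj => //; apply: lifts_unique.
Qed.

(** * Soundness of the relations and bijectivity *)

Local Notation val_out := (@incl (Out G) (pureOut_pred Gi)).

Lemma fplift_genf i j (ij : i != j) (a : K i) :
  fplift (gen_hom spl) (genf spl ij a) = pconj_class spl ij a.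
Proof. exact: fplift_in. Qed.

Lemma fplift_genphi phi : fplift (gen_hom spl) (genphi spl phi) = fact_class spl phi.
Proof. exact: fplift_in. Qed.

Lemma pure_comm (c d : pureOut Gi) (f g : aut G) :
  val_out c = qproj _ f -> val_out d = qproj _ g -> commute f g -> [~ c, d] = 1.
Proof.
move=> hf hg fg; apply/eqP/commgP; apply: val_inj.
by rewrite !valM /= hf hg -!gmulfM fg.
Qed.

Lemma pure_rel_sound p q : @pure_rel G n Gi spl p q ->
  fplift (gen_hom spl) p = fplift (gen_hom spl) q.
Proof.
case=> [i j k ij ik a c jk|i j k l ij kl a c|i j k ij ik jk a c|i v iv a vinj|i j ij a phi].
- rewrite hom1 fpliftR !fplift_genf; apply: pure_comm => //.
  by apply: pconj_comm => //; rewrite eq_sym.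
- rewrite /= !inE !negb_or => /and4P[/and3P[_ ik il] /andP[jk jl] _ _].
  rewrite hom1 fpliftR !fplift_genf; apply: pure_comm => //.
  by apply: pconj_comm => //; rewrite eq_sym.
- rewrite hom1 fpliftR fplift_morph !fplift_genf.
  (* [pconj_hex] wants first the factor whose target is that of the other move, so the product is
     reversed; its factors commute. *)
  apply: (@pure_comm _ _ _ (pconj spl ik c * pconj spl ij c)) => //; last exact: pconj_hex.
  rewrite valM /= -gmulfM; congr (qproj _ _).
  by apply: pconj_comm => //; rewrite eq_sym.
- have E : val_out (fplift (gen_hom spl) (\prod_(m < n.-1) genf spl (iv m) a)) =
      qproj _ (\prod_(m < n.-1) pconj spl (iv m) a).
    apply: (big_ind2 (fun p f => val_out (fplift (gen_hom spl) p) = qproj _ f)) => [||m _].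
    + by rewrite !hom1.
    + by move=> x f y g hx hy; rewrite fplift_morph valM /= hx hy gmulfM.
    + by rewrite fplift_genf.
  rewrite fplift_genphi; apply: val_inj; rewrite -[LHS]/(val_out _) E.
  rewrite -[RHS]/(qproj (@Inn G) (fact_aut spl (Ad a))).
  apply/(@qprojP _ (@Inn G)).
  (* The product for [a] followed by [Ad a^-1] is conjugation by [a^-1], and [Ad a^-1] is inverse to
     [Ad a]. *)
  apply/asboolP; exists (incl a^-1).
  have /= := prod_pconj_inn iv a^-1 vinj; rewrite invgK => <-.
  congr (_ * _); apply: (@mulgI _ (fact_aut spl (Ad a))).
  by rewrite mulgV -fact_autM -[X in fact_aut _ X]AdM mulgV Ad1 fact_aut1.
- rewrite !fplift_morph fpliftV fplift_genphi !fplift_genf; apply: (mulgI (fact_class spl phi)).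
  rewrite -mulgA mulVKg; apply: val_inj.
  by rewrite !valM /= -!gmulfM pconj_fact.
Qed.

Lemma lifts_class psi c : lifts psi c -> exists2 p, c = cls p &
  val_out (fplift (gen_hom spl) p) = qproj _ psi.
Proof.
elim=> [phi|i j ij a {}psi {}c _ _ [p -> E]].
  by exists (genphi spl phi); rewrite ?fplift_genphi.
exists (genf spl ij a * p); first by rewrite gmulfM.
by rewrite fplift_morph fplift_genf valM /= E gmulfM.
Qed.

Lemma presents_pureOut : presents (gen_hom spl) (@pure_rel G n Gi spl).
Proof.
apply: presents_intro pure_rel_sound _ _ => [p hp|[c hc]].
  have [psi hpsi] := lifts_total (cls p).
  have [q Eq hq] := lifts_class hpsi.
  (* [p] lies in the kernel, so [psi] is inner; then 1 is also a lift of [psi], and uniqueness gives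
     [cls p = 1]. *)
  move: hq; rewrite -(fplift_qproj pure_rel_sound Eq) hp hom1 -(hom1 (qproj (@Inn G))).
  move/esym/qprojP; rewrite divg1 => /asboolP[g E].
  by rewrite -(hom1 cls); apply: lifts_unique hpsi _; rewrite E hom1; apply: lifts_inn.
have /asboolP[psi [E hpsi]] := hc; have [d hd] := lifts_exists hpsi.
have [p _ hp] := lifts_class hd; exists p; apply: val_inj.
by rewrite -[LHS]/(val_out _) hp /= E.
Qed.

End Splitting.

Theorem theorem4p1p1 (G : groupType) (n : nat) (Gi : 'I_n -> groupClosed G)
    (spl : free_splitting Gi) (n_ge5 : (5 <= n)%N)
    (Gi_neq1 : forall i : 'I_n, exists x : G, x \in Gi i /\ x <> 1) :
  presents (gen_hom spl) (@pure_rel G n Gi spl).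
Proof. exact: presents_pureOut. Qed.
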